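(* Suppose $X^+=\mathcal A^{\mathbb N_0}$ is a one-sided full shift and $X_0^+$ is a proper subshift of $X^+$. Then the potential $\phi^+:X^+\to\mathbb R$ defined by $\phi^+(x)=0$ if $x\in X_0^+$ and $\phi^+(x)=-a_j$ if $\mathrm{dist}(x,X_0^+)=2^{-j}$ has a freezing phase transition with $\mathrm{ZTA}(\phi^+)$ consisting of measures of maximal entropy of $X_0^+$ provided the decreasing sequence $(a_j)$ satisfies \[ a_{3j}\ge \frac{2\log j}{j}+\frac{1}{j}\sum_{i=0}^{\lfloor \log_2 j\rfloor}2^i\kappa_{i} +\frac{1}{j}, \] where $\kappa_i=\frac{\log |\mathcal L_{2^i}(X_0^+)|}{2^i}-h_{\mathrm{top}}(X_0^+)$.
   Context: $\mathcal A$ finite; $\mathrm{dist}(x,y)=2^{-n}$ where $n$ is the first index at which $x,y$ differ. $\mathcal L_m(X_0^+)$ is the set of words of length $m$ appearing in $X_0^+$; $h_{\mathrm{top}}$ is topological entropy. Equilibrium states of $\beta\phi^+$: shift-invariant probability measures maximizing $h(\mu)+\beta\int\phi^+d\mu$ ($h$ = measure-theoretic entropy). Freezing phase transition at $\beta_c$: equilibrium state sets equal for all $\beta,\beta'>\beta_c$ and different for $\beta<\beta_c<\beta'$. $\mathrm{ZTA}(\phi^+)$ is the set of vague limits of $\mu_n\in\mathrm{ES}(\beta_n\phi^+)$ with $\beta_n\to\infty$. *)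

(* Defs.v *)
From HB Require Import structures.
From mathcomp Require Import all_boot all_order all_algebra.
From mathcomp Require Import all_classical all_reals all_analysis.
Unset Printing Implicit Defensive.
Import Order.TTheory GRing.Theory Num.Theory numFieldNormedType.Exports.
Local Open Scope classical_set_scope.
Local Open Scope ring_scope.

(* One-sided full shift A^{N_0} over a finite (nonempty, witnessed by a0)
   alphabet A.  The point a0 is only needed to give the type the
   pointedType structure required by mathcomp-analysis measurable types. *)
Definition seqA {A : finType} (a0 : A) : Type := nat -> A.
HB.instance Definition _ (A : finType) (a0 : A) := Choice.on (seqA a0).
HB.instance Definition _ (A : finType) (a0 : A) :=
  isPointed.Build (seqA a0) (fun _ => a0).

Definition cyl {A : finType} (a0 : A) {n : nat} (w : n.-tuple A) : set (seqA a0) :=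
  [set x | forall i : 'I_n, x i = tnth w i].

Definition cylinders {A : finType} (a0 : A) : set (set (seqA a0)) :=
  [set C | exists n (w : n.-tuple A), C = cyl a0 w].

(* the shift space with the sigma-algebra generated by cylinders
   (= Borel sigma-algebra of the product topology / of the metric dist) *)
Definition ShiftSpace {A : finType} (a0 : A) := g_sigma_algebraType (cylinders a0).

Section ShiftDefs.
Context {R : realType} {A : finType} {a0 : A}.
Local Notation X := (ShiftSpace a0).

Definition shift (x : X) : X := fun n => x n.+1.

Definition first_diff (x y : X) : nat :=
  xget 0%N [set n | x n <> y n /\ forall i, (i < n)%N -> x i = y i].

Definition dist (x y : X) : R :=
  if `[< x = y >] then 0 else (2^-1) ^+ first_diff x y.

Definition dist_set (x : X) (Y : set X) : R := inf [set dist x y | y in Y].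

Definition is_subshift (Y : set X) : Prop :=
  Y !=set0 /\
  (forall x, Y x -> Y (shift x)) /\
  (forall x, (forall e : R, 0 < e -> exists y, Y y /\ dist x y < e) -> Y x).

Definition language (n : nat) (Y : set X) : {set n.-tuple A} :=
  [set w | `[< exists x, Y x /\ cyl a0 w x >]].

Definition htop (Y : set X) : R :=
  limn (fun n : nat => ln (#|language n Y|%:R : R) / n%:R : R).

Definition kappa (Y : set X) (i : nat) : R :=
  ln (#|language (2 ^ i) Y|%:R) / (2 ^ i)%:R - htop Y.

(* measure-theoretic (Kolmogorov-Sinai) entropy of a shift-invariant measure,
   computed with the generating partition into cylinders *)
Definition Hn (mu : probability X R) (n : nat) : R :=
  \sum_(w : n.-tuple A) - (fine (mu (cyl a0 w)) * ln (fine (mu (cyl a0 w)))).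

Definition ent (mu : probability X R) : R := limn (fun n : nat => Hn mu n / n%:R : R).

Definition invariant (mu : probability X R) : Prop :=
  forall B : set X, measurable B -> mu (shift @^-1` B) = mu B.

Definition ES (phi : X -> R) (beta : R) : set (probability X R) :=
  [set mu | invariant mu /\
    forall nu : probability X R, invariant nu ->
      ((ent nu)%:E + beta%:E * \int[nu]_x (phi x)%:E <=
       (ent mu)%:E + beta%:E * \int[mu]_x (phi x)%:E)%E].

Definition freezing_phase_transition (phi : X -> R) : Prop :=
  exists betac : R,
    (forall b b', betac < b -> betac < b' -> ES phi b = ES phi b') /\
    (forall b b', b < betac -> betac < b' -> ES phi b <> ES phi b').

Definition dcontinuous (f : X -> R) : Prop :=
  forall x (e : R), 0 < e -> exists2 d : R, 0 < d &
    forall y, dist x y < d -> `|f x - f y| < e.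

Definition ZTA (phi : X -> R) : set (probability X R) :=
  [set mu | exists (beta : nat -> R) (mus : nat -> probability X R),
     beta @ \oo --> +oo /\
     (forall n, ES phi (beta n) (mus n)) /\
     (forall f, dcontinuous f ->
        (fun n => (\int[mus n]_x (f x)%:E)%E) @ \oo --> (\int[mu]_x (f x)%:E)%E)].

Definition mme (Y : set X) : set (probability X R) :=
  [set mu | invariant mu /\ mu Y = 1%E /\ ent mu = htop Y].

End ShiftDefs.

(* Main.v *)
(* Write l(s) for the length of the longest prefix of shift^s x that belongs to
   the language L of X0, so that phi (shift^s x) = - a (l(s)), and cut x greedily
   into words of L whose lengths are the largest possible powers of 2, up to a
   cap 2^K.  If a piece of length 2^p is followed by a piece of length
   2^i <= 2^p with i < K, then l(s) <= 3 * 2^p at each of its positions s, so this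
   piece costs at least 2^p a (3 * 2^p), which by hypothesis dominates
   2 p log 2 + 1 + sum_(i <= p) 2^i kappa_i.  This pays for the excess of
   log |L_(2^i)| over 2^i htop summed along the strictly increasing run of scales
   that ends there.  Summing the weights over all parses bounds the partition
   function of b * phi by exp (n (htop + o(1))) for some b, that is,
   h(mu) + b \int phi dmu <= htop X0 for every invariant mu.  For larger b
   equality forces \int phi dmu = 0, so the equilibrium states are exactly the
   measures of maximal entropy of X0; the critical value is the infimum of the
   admissible b, finite because a measure of full support has \int phi dmu < 0. *)
Require Import Defs.
From HB Require Import structures.
From mathcomp Require Import all_boot all_order all_algebra.
From mathcomp Require Import all_classical all_reals all_analysis.
From mathcomp Require Import measurable_realfun.
From mathcomp Require Import ring lra zify.
Import Order.TTheory GRing.Theory Num.Theory numFieldNormedType.Exports.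
(* mathcomp also defines shift, invariant and first_diff. *)
Import Defs.
Local Open Scope classical_set_scope.
Local Open Scope ring_scope.

Set Implicit Arguments.
Unset Strict Implicit.

(** * Entropy inequalities and sums over words *)

(** An increasing run of scales pays only when it ends, and along a point of [X0] it never ends; the
    cap closes this gap. A piece at scale [K] asks no payment of its predecessor, and the excess
    left over is absorbed by raising the growth rate to [htop X0 + kappa X0 K + ln 2 / 2 ^ K]. The
    value of b needed does not depend on [K], so letting [K] grow restores [htop X0]. The sum over
    parses is not enumerated run by run: it is dominated by a positive supersolution [th] of the
    recursion on the last scale. The term 2 log j of the hypothesis yields a factor 4^-p per
    payment, which beats the 3^-p in [th], and the term 1/j yields [expR (- beta)], which supplies
    the constants. The bound is useful only if [X0] carries a measure of maximal entropy, and such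
    measures must survive vague limits. Both facts rest on one observation: word entropy is an
    infimum of cross entropies against strictly positive distributions, and these are linear in
    finitely many cylinder masses, so limits are taken word by word. *)

Section Reals.
Context {R : realType}.

(** Termwise [ln t <= t - 1] at [t = q / p]. Letting [q] vanish where [p] does is what the product
    of marginals in [Hword_subadditive] needs. *)
Lemma gibbs (I : finType) (p q : I -> R) :
  (forall i, 0 <= p i) -> (forall i, 0 <= q i) ->
  (forall i, q i = 0 -> p i = 0) -> \sum_i q i <= \sum_i p i ->
  \sum_i - (p i * ln (p i)) <= \sum_i - (p i * ln (q i)).
Proof.
move=> p0 q0 qp qs; rewrite -subr_ge0 -sumrB.
apply: (@le_trans _ _ (\sum_i (p i - q i))); first by rewrite sumrB subr_ge0.
apply: ler_sum => i _.
have [pi0|pi0] := eqVneq (p i) 0.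
  by rewrite pi0 !mul0r oppr0 subr0 sub0r oppr_le0.
have qi : 0 < q i by rewrite lt_neqAle q0 andbT eq_sym; apply: contra_neq pi0 => /qp.
have pi : 0 < p i by rewrite lt_neqAle p0 andbT eq_sym.
have := @le_ln1Dx R (q i / p i - 1).
rewrite ltrBrDr addNr divr_gt0 // => /(_ isT).
rewrite [1 + _]addrC subrK ln_div ?posrE// => h.
have : p i * (ln (q i) - ln (p i)) <= p i * (q i / p i - 1) by rewrite ler_pM2l.
have -> : p i * (q i / p i - 1) = q i - p i by field.
lra.
Qed.

(** The finite Gibbs variational principle: [gibbs] against the normalized weights [W / Z]. *)
Lemma gibbs_partition (I : finType) (p W : I -> R) :
  (forall i, 0 <= p i) -> \sum_i p i = 1 -> (forall i, 0 < W i) ->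
  \sum_i - (p i * ln (p i)) + \sum_i p i * ln (W i) <= ln (\sum_i W i).
Proof.
move=> p0 p1 W0; set Z := \sum_i W i.
have [i0 _] : exists i : I, true.
  apply/existsP; rewrite -[[exists _, _]]negbK; apply/negP => /existsPn h.
  move: p1; rewrite big1 => [/esym/eqP|i _]; first by rewrite oner_eq0.
  by have := h i.
have Z0 : 0 < Z.
  by rewrite /Z (bigD1 i0)//= ltr_pwDl// sumr_ge0// => i _; exact: ltW.
have := @gibbs I p (fun i => W i / Z) p0 (fun i => ltW (divr_gt0 (W0 i) Z0)).
have -> : \sum_i - (p i * ln (W i / Z)) = ln Z - \sum_i p i * ln (W i).
  rewrite -[X in X - _]mul1r -p1 mulr_suml -sumrB; apply: eq_bigr => i _.
  by rewrite ln_div ?posrE//; lra.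
rewrite -mulr_suml divff ?gt_eqF// p1 lerBrDr; apply=> // i /eqP.
by rewrite gt_eqF ?divr_gt0.
Qed.

Lemma fekete (u : nat -> R) :
  (forall n, 0 <= u n) -> (forall m n, u (m + n)%N <= u m + u n) ->
  cvgn (fun n => u n / n%:R) /\
  forall n, (0 < n)%N -> limn (fun n => u n / n%:R) <= u n / n%:R.
Proof.
move=> u0 uD.
pose E := [set u n / n%:R | n in [set n | (0 < n)%N]].
have lbE : lbound E 0 by move=> _ [n /= n0 <-]; rewrite divr_ge0.
have E0 : E !=set0 by exists (u 1%N / 1%:R), 1%N.
have iE n : (0 < n)%N -> inf E <= u n / n%:R.
  by move=> n0; apply: ge_inf; [exists 0|exists n].
have uM m q : u (q * m)%N <= q%:R * u m + u 0%N.
  elim: q => [|q IH]; first by rewrite mul0r add0r mul0n.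
  by rewrite mulSn; have := uD m (q * m)%N; rewrite -natr1; move: IH; lra.
(* Euclidean division of [n] by [m]; the remainder costs at most [m * u 1], and each use of [uM]
   adds one [u 0], which need not vanish. *)
have uq m n : (0 < m)%N ->
    u n <= n%:R * (u m / m%:R) + (u 0%N + m%:R * u 1%N + u 0%N).
  move=> m0; have := uM 1%N (n %% m)%N; rewrite muln1.
  have := uM m (n %/ m)%N; have := uD (n %/ m * m)%N (n %% m)%N.
  rewrite -divn_eq.
  have : (n %% m)%:R * u 1%N <= m%:R * u 1%N.
    by rewrite ler_wpM2r// ler_nat ltnW// ltn_pmod.
  have : (n %/ m)%:R * u m <= n%:R * (u m / m%:R).
    rewrite mulrCA [X in _ <= X]mulrC ler_wpM2r//.
    by rewrite ler_pdivlMr ?ltr0n// -natrM ler_nat leq_divM.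
  lra.
suff cu : (fun n => u n / n%:R) @ \oo --> inf E.
  split; first by apply/cvg_ex; exists (inf E).
  by move=> n n0; rewrite (cvg_lim _ cu)//; exact: iE.
apply/cvgrPdist_le => e e0.
have e20 : 0 < e / 2 by rewrite divr_gt0.
have [_ [m /= m0 <-] hm] := inf_adherent e20 (conj E0 (ex_intro _ 0 lbE)).
set C := u 0%N + m%:R * u 1%N + u 0%N.
have C0 : 0 <= C by rewrite !addr_ge0// mulr_ge0.
have [N hN] : exists N : nat, C / (e / 2) < N%:R.
  by exists (Num.Def.archi_bound (C / (e / 2))); apply: archi_boundP; rewrite divr_ge0// ltW.
exists N.+1 => // n /= Nn.
have n0 : (0 < n)%N by apply: leq_trans Nn.
rewrite ler0_norm; last by rewrite subr_le0 iE.
rewrite opprB lerBlDr.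
have := uq m n m0; rewrite -/C => h.
have h1 : u n / n%:R <= u m / m%:R + C / n%:R.
  rewrite ler_pdivrMr ?ltr0n// mulrDl divfK ?pnatr_eq0 -?lt0n//.
  by rewrite [X in X + _]mulrC.
have h2 : C / n%:R <= e / 2.
  rewrite ler_pdivrMr ?ltr0n// -ler_pdivrMl// mulrC.
  by rewrite (le_trans (ltW hN))// ler_nat ltnW.
move: (ltW hm) h1 h2; lra.
Qed.

(** A limit along an ultrafilter replaces a diagonal subsequence: the masses of all words converge
    at once. *)
Lemma ultra_bounded_cvg (U : set_system nat) (v : nat -> R) (M : R) :
  UltraFilter U -> (forall n, `|v n| <= M) -> cvg (v @ U).
Proof.
move=> UU vM.
have PU : ProperFilter U by exact: ultra_proper.
have UI : (v @ U) `[- M, M]%classic.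
  by apply: (@filterE _ U) => n; rewrite /= in_itv/= -ler_norml vM.
have [l [_ cl]] := @segment_compact R (- M) M (v @ U) _ UI.
apply/cvg_ex; exists l => V Vl.
have [//|Uc] := in_ultra_setVsetC (v @^-1` V) UU.
have vU : (v @ U) (v @` (~` (v @^-1` V))).
  by apply: (@filterS _ U _ _ _ _ Uc) => n nV; exists n.
by have [y [/= [n nV <-] Vy]] := cl _ V vU Vl.
Qed.
End Reals.

(** * Sums over words and stationary word functions *)

Section WordSums.
Context {R : realType} {A : finType}.
Implicit Types F : seq A -> R.

Lemma sumwS n F : \sum_(w : n.+1.-tuple A) F w =
  \sum_a \sum_(w : n.-tuple A) F (a :: w).
Proof.
rewrite pair_big/= (reindex (fun p : A * n.-tuple A => [tuple of p.1 :: p.2]))//=.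
exists (fun w => (thead w, [tuple of behead w])) => [[a w] _|w _] /=.
  by congr (_, _); apply: val_inj.
by rewrite -tuple_eta.
Qed.

Lemma sumw0 F : \sum_(w : 0.-tuple A) F w = F [::].
Proof.
by rewrite (big_pred1 [tuple])// => w; rewrite [w]tuple0 /= eqxx.
Qed.

Lemma sumw_cat m n F : \sum_(w : (m + n).-tuple A) F w =
  \sum_(u : m.-tuple A) \sum_(v : n.-tuple A) F (u ++ v).
Proof.
elim: m F => [|m IH] F.
  by rewrite (sumw0 (fun u => \sum_(v : n.-tuple A) F (u ++ v))).
rewrite (sumwS _ (fun u => \sum_(v : n.-tuple A) F (u ++ v))) (sumwS (m + n)).
by apply: eq_bigr => a _; rewrite -(IH (fun w => F (a :: w))).
Qed.

Lemma sumw_split m n F : (m <= n)%N -> \sum_(w : n.-tuple A) F w =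
  \sum_(u : m.-tuple A) \sum_(v : (n - m).-tuple A) F (u ++ v).
Proof. by move=> mn; rewrite -sumw_cat subnKC. Qed.

Lemma sumw_rcons n F : \sum_(w : n.+1.-tuple A) F w =
  \sum_(w : n.-tuple A) \sum_a F (rcons w a).
Proof.
rewrite -addn1 sumw_cat; apply: eq_bigr => u _.
rewrite (sumwS _ (fun v => F (u ++ v))); apply: eq_bigr => a _.
by rewrite (sumw0 (fun v => F (u ++ a :: v))) cats1.
Qed.

Lemma sumw_rev_split n F : \sum_(w : n.+1.-tuple A) F w =
  \sum_(w : n.-tuple A) \sum_a F (a :: w).
Proof. by rewrite sumwS exchange_big. Qed.

(** Kolmogorov consistency of cylinder masses; the left-hand extension in [stationary] encodes shift
    invariance. *)
Definition consistent (m : seq A -> R) :=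
  [/\ forall w, 0 <= m w, m [::] = 1 & forall w, \sum_a m (rcons w a) = m w].

Definition stationary (m : seq A -> R) :=
  consistent m /\ forall w, \sum_a m (a :: w) = m w.

Definition Hword (m : seq A -> R) n := \sum_(w : n.-tuple A) - (m w * ln (m w)).

Lemma consistent_cat m n u : consistent m ->
  \sum_(v : n.-tuple A) m (u ++ v) = m u.
Proof.
move=> [_ _ mr]; elim: n => [|n IH].
  by rewrite (sumw0 (fun v => m (u ++ v))) cats0.
rewrite (sumw_rcons _ (fun v => m (u ++ v))) -[RHS]IH; apply: eq_bigr => v _.
by rewrite -mr; apply: eq_bigr => a _; rewrite rcons_cat.
Qed.

Lemma stationary_cat m n v : stationary m ->
  \sum_(u : n.-tuple A) m (u ++ v) = m v.
Proof.
move=> [_ ml]; elim: n => [|n IH]; first by rewrite (sumw0 (fun u => m (u ++ v))).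
rewrite (sumw_rev_split _ (fun u => m (u ++ v))) -[RHS]IH.
by apply: eq_bigr => u _; rewrite -ml.
Qed.

Lemma consistent_sum m n : consistent m -> \sum_(v : n.-tuple A) m v = 1.
Proof. by move=> mc; have := consistent_cat n [::] mc; case: mc => _ ->. Qed.

Lemma consistent_le1 m w : consistent m -> m w <= 1.
Proof.
move=> mc; have [m0 _ _] := mc; rewrite -(consistent_sum (size w) mc).
by rewrite (bigD1 (in_tuple w))//= lerDl sumr_ge0.
Qed.

Lemma Hword_ge0 m n : consistent m -> 0 <= Hword m n.
Proof.
move=> mc; apply: sumr_ge0 => w _; rewrite oppr_ge0 mulr_ge0_le0//.
  by case: mc.
by rewrite ln_le0// consistent_le1.
Qed.

(** Cross entropy against the product of the two marginals; stationarity identifies the second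
    marginal with [m] itself. *)
Lemma Hword_subadditive m : stationary m ->
  forall k n, Hword m (k + n)%N <= Hword m k + Hword m n.
Proof.
move=> ms k n; have [mc _] := ms; have [m0 _ _] := mc.
pose q (w : seq A) := m (take k w) * m (drop k w).
have qE (u : k.-tuple A) v : q (u ++ v) = m u * m v.
  by rewrite /q take_size_cat ?size_tuple// drop_size_cat ?size_tuple.
have mu0 u v : m u = 0 -> m (u ++ v) = 0.
  move=> u0; apply/eqP; rewrite eq_le m0 andbT -u0 -(consistent_cat (size v) u mc).
  by rewrite (bigD1 (in_tuple v))//= lerDl sumr_ge0.
have mv0 u v : m v = 0 -> m (u ++ v) = 0.
  move=> v0; apply/eqP; rewrite eq_le m0 andbT -v0 -(stationary_cat (size u) v ms).
  by rewrite (bigD1 (in_tuple u))//= lerDl sumr_ge0.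
apply: (@le_trans _ _ (\sum_(w : (k + n).-tuple A) - (m w * ln (q w)))).
  apply: (@gibbs _ _ (fun w : (k + n).-tuple A => m w) (fun w => q w)) => [//|w|w|].
  - by rewrite mulr_ge0.
  - move=> /eqP; rewrite mulf_eq0 => /orP[]/eqP h.
      by rewrite -(cat_take_drop k w) mu0.
    by rewrite -(cat_take_drop k w) mv0.
  - rewrite (sumw_cat _ _ q) consistent_sum//.
    under eq_bigr => u _ do (under eq_bigr => v _ do rewrite qE; rewrite -mulr_sumr consistent_sum// mulr1).
    by rewrite consistent_sum.
rewrite (sumw_cat _ _ (fun w => - (m w * ln (q w)))).
have -> : Hword m k + Hword m n = \sum_(u : k.-tuple A) \sum_(v : n.-tuple A)
   (- (m (u ++ v) * ln (m u)) - m (u ++ v) * ln (m v)).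
  under [RHS]eq_bigr => u _ do rewrite big_split/=.
  rewrite big_split/=; congr (_ + _).
    apply: eq_bigr => u _; rewrite sumrN -mulr_suml consistent_cat//.
  rewrite exchange_big/=; apply: eq_bigr => v _.
  by rewrite sumrN -mulr_suml stationary_cat.
apply: ler_sum => u _; apply: ler_sum => v _; rewrite qE.
have [/eqP/mu0 ->|u0] := boolP (m u == 0); first by rewrite !mul0r oppr0 addr0.
have [/eqP/mv0 ->|v0] := boolP (m v == 0); first by rewrite !mul0r oppr0 addr0.
rewrite lnM ?posrE ?lt_neqAle ?m0 ?andbT 1?eq_sym//; lra.
Qed.

End WordSums.

(** * The shift space and its invariant measures *)

Lemma measure_fintype_bigcup {d} {T : measurableType d} {R : realType}
    (mu : measure T R) (I : finType) (F : I -> set T) :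
  (forall i, measurable (F i)) -> trivIset setT F ->
  mu (\bigcup_(i in [set: I]) F i) = (\sum_i mu (F i))%E.
Proof.
move=> mF tF; have e : [set: I] = [set` index_enum I].
  by apply/seteqP; split => i //= _; rewrite mem_index_enum.
rewrite measure_fin_bigcup// e; last exact: finite_seq.
by apply/esym/fsbig_seq; exact: index_enum_uniq.
Qed.

Section ShiftBasics.
Context {R : realType} {A : finType} {a0 : A}.
Local Notation X := (ShiftSpace a0).
Implicit Types (x y : X) (mu : probability X R).

Definition pre (n : nat) (x : X) : seq A := mkseq x n.

Lemma size_pre n x : size (pre n x) = n.
Proof. exact: size_mkseq. Qed.

Lemma cylE n (w : n.-tuple A) : cyl a0 w = [set x | pre n x = w].
Proof.
apply/seteqP; split => x /= h.
  apply: (@eq_from_nth _ a0); rewrite ?size_pre ?size_tuple// => i ilt.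
  by rewrite nth_mkseq// (h (Ordinal ilt)) (tnth_nth a0).
by move=> i; rewrite (tnth_nth a0) -h nth_mkseq.
Qed.

Lemma pre_shift n x : pre n.+1 x = x 0%N :: pre n (shift x).
Proof. by rewrite /pre /mkseq /= -[1%N]addn0 iotaDl -map_comp. Qed.

Lemma preS n x : pre n.+1 x = rcons (pre n x) (x n).
Proof. by rewrite /pre mkseqS. Qed.

Lemma pre_cat k n x : pre (k + n) x = pre k x ++ pre n (iter k shift x).
Proof.
elim: k x => [|k IH] x //.
by rewrite addSn !pre_shift IH -iterSr.
Qed.

Lemma take_pre k n x : (k <= n)%N -> take k (pre n x) = pre k x.
Proof. by move=> kn; rewrite -(subnKC kn) pre_cat take_size_cat ?size_pre. Qed.

Lemma drop_pre k n x : (k <= n)%N ->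
  drop k (pre n x) = pre (n - k) (iter k shift x).
Proof. by move=> kn; rewrite -{1}(subnKC kn) pre_cat drop_size_cat ?size_pre. Qed.

Lemma eq_pre n x y : pre n x = pre n y <-> forall i, (i < n)%N -> x i = y i.
Proof.
split=> [h i ilt|h]; last first.
  by apply: (@eq_from_nth _ a0); rewrite ?size_pre// => i ilt; rewrite !nth_mkseq ?h.
by rewrite -[x i](@nth_mkseq _ a0 x n)// -[y i](@nth_mkseq _ a0 y n)//; congr nth.
Qed.

Lemma measurable_cyl n (w : n.-tuple A) : measurable (cyl a0 w : set X).
Proof. by apply: sub_gen_smallest; exists n, w. Qed.

Lemma measurable_pre n (P : set (seq A)) : measurable ([set x | P (pre n x)] : set X).
Proof.
have -> : [set x | P (pre n x)] = \bigcup_(w in [set w : n.-tuple A | P w]) cyl a0 w.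
  apply/seteqP; split => x /=.
    move=> Px; have s : size (pre n x) == n by rewrite size_pre.
    by exists (Tuple s) => //; rewrite cylE.
  by move=> [w /= Pw]; rewrite cylE/= => ->.
by apply: fin_bigcup_measurable => // w _; exact: measurable_cyl.
Qed.

Lemma measurable_shift : measurable_fun setT (shift : X -> X).
Proof.
apply: (@measurability _ _ X X setT shift (cylinders a0)) => //.
move=> _ [_ [n [w ->]] <-]; rewrite setTI.
have -> : shift @^-1` cyl a0 w = [set x | behead (pre n.+1 x) = w].
  by rewrite cylE; apply/seteqP; split => x; rewrite /preimage [in X in X -> _]/mkset [in X in _ -> X]/mkset pre_shift.
exact: (@measurable_pre n.+1 (fun s => behead s = w)).
Qed.

Lemma measurable_iter_shift k : measurable_fun setT (iter k shift : X -> X).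
Proof.
elim: k => [|k IH]; first exact: measurable_id.
exact: measurableT_comp measurable_shift IH.
Qed.

Definition mass mu (w : seq A) : R := fine (mu [set x | pre (size w) x = w]).

Lemma massE mu n (w : n.-tuple A) : fine (mu (cyl a0 w)) = mass mu w.
Proof. by rewrite cylE /mass size_tuple. Qed.

Lemma mu_mass mu w : mu [set x | pre (size w) x = w] = (mass mu w)%:E.
Proof. by rewrite fineK// fin_num_measure//; exact: (@measurable_pre _ [set w]). Qed.

Lemma mu_cyl mu n (w : n.-tuple A) : mu (cyl a0 w) = (mass mu w)%:E.
Proof. by rewrite -mu_mass size_tuple cylE. Qed.

Lemma mass_consistent mu : consistent (mass mu).
Proof.
split=> [w||w]; first exact: fine_ge0.
  by rewrite /mass (_ : [set _ | _] = setT) ?probability_setT//; apply/seteqP; split.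
apply: EFin_inj; rewrite -mu_mass -sumEFin.
have -> : [set x | pre (size w) x = w] =
    \bigcup_(a in [set: A]) [set x | pre (size (rcons w a)) x = rcons w a].
  apply/seteqP; split => x /=.
    by move=> h; exists (x (size w)) => //=; rewrite size_rcons preS h.
  by move=> [a _ /=]; rewrite size_rcons preS => /rcons_inj[].
rewrite measure_fintype_bigcup; last 2 first.
- move=> a; exact: (@measurable_pre _ [set rcons w a]).
- by move=> a b _ _ [x [/= h1 h2]]; move: h2; rewrite !size_rcons -(size_rcons w a) h1 => /rcons_inj[].
by apply: eq_bigr => a _; rewrite -mu_mass.
Qed.

Lemma mass_shift mu w :
  mu (shift @^-1` [set x | pre (size w) x = w]) = (\sum_a mass mu (a :: w))%:E.
Proof.
rewrite -sumEFin.
have -> : shift @^-1` [set x | pre (size w) x = w] =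
    \bigcup_(a in [set: A]) [set x | pre (size (a :: w)) x = a :: w].
  apply/seteqP; split => x /=.
    by move=> h; exists (x 0%N) => //=; rewrite pre_shift h.
  by move=> [a _ /=]; rewrite pre_shift => -[].
rewrite measure_fintype_bigcup; last 2 first.
- move=> a; exact: (@measurable_pre _ [set a :: w]).
- by move=> a b _ _ [x [/= h1 h2]]; move: h2; rewrite h1 => -[].
by apply: eq_bigr => a _; rewrite -mu_mass.
Qed.

Lemma mass_stationary mu : invariant mu -> stationary (mass mu).
Proof.
move=> imu; split=> [|w]; first exact: mass_consistent.
apply: EFin_inj; rewrite -mu_mass -imu; last exact: (@measurable_pre _ [set w]).
by rewrite mass_shift.
Qed.

Lemma HnE mu n : Hn mu n = Hword (mass mu) n.
Proof. by apply: eq_bigr => w _; rewrite massE. Qed.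

Lemma entE mu : ent mu = limn (fun n => Hword (mass mu) n / n%:R).
Proof.
rewrite /ent; suff -> : (fun n => Hn mu n / n%:R) = fun n => Hword (mass mu) n / n%:R by [].
by apply/funext => n; rewrite HnE.
Qed.

(** The limit defining entropy is an infimum by [fekete], so every finite level bounds it. *)
Lemma ent_le mu n : invariant mu -> (0 < n)%N -> ent mu * n%:R <= Hword (mass mu) n.
Proof.
move=> imu n0; have sm := mass_stationary imu; have cm := mass_consistent mu.
have [_ h] := fekete (fun n => @Hword_ge0 _ _ _ n cm) (Hword_subadditive sm).
by by rewrite -ler_pdivlMr ?ltr0n// entE h.
Qed.

Lemma le_ent mu c : invariant mu ->
  (forall n, (0 < n)%N -> c * n%:R <= Hword (mass mu) n) -> c <= ent mu.
Proof.
move=> imu h; have sm := mass_stationary imu; have cm := mass_consistent mu.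
have [cv _] := fekete (fun n => @Hword_ge0 _ _ _ n cm) (Hword_subadditive sm).
rewrite entE; apply: limr_ge => //; near=> n.
have n0 : (0 < n)%N by near: n; exists 1%N.
by rewrite ler_pdivlMr ?ltr0n// h.
Unshelve. all: by end_near. Qed.

(* Cylinders together with the empty set form a generating pi-system. *)
Lemma eq_mass (mu nu : measure X R) : 
  (forall n (w : n.-tuple A), mu (cyl a0 w) = nu (cyl a0 w)) ->
  (mu setT < +oo)%E ->
  forall B, measurable B -> mu B = nu B.
Proof.
move=> h mufin; pose G : set (set X) := cylinders a0 `|` [set set0].
have GT : G setT by left; exists 0%N, [tuple]; rewrite cylE; apply/seteqP; split.
apply: (@measure_unique _ _ _ G (fun=> setT)) => //.
- apply/seteqP; split => B.
    by apply: sub_sigma_algebra2 => C; left.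
  apply: smallest_sub; first exact: sigma_algebra_measurable.
  move=> C [[n [w ->]]|->]; first exact: measurable_cyl.
  exact: measurable0.
- have I n k (w : n.-tuple A) (v : k.-tuple A) : (n <= k)%N -> G (cyl a0 w `&` cyl a0 v).
    move=> nk; have [e|ne] := eqVneq (take n v) w.
      left; exists k, v; rewrite setIC; apply/setIidPl => x.
      by rewrite !cylE/= -(take_pre x nk) => ->.
    right; apply/eqP/negPn; apply/negP => /set0P[x []]; rewrite !cylE/= => h1 h2.
    by move/eqP: ne; apply; rewrite -h2 take_pre.
  move=> B C [[n [w ->]]|->]; last by rewrite set0I => _; right.
  move=> [[k [v ->]]|->]; last by rewrite setI0; right.
  by have [nk|/ltnW kn] := leqP n k; [exact: I|rewrite setIC; exact: I].
- by rewrite bigcup_const.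
- by move=> C [[n [w ->]]|->]; [exact: h|rewrite !measure0].
Qed.

HB.instance Definition _ :=
  isMeasurableFun.Build _ _ X X (@Defs.shift A a0) measurable_shift.

(** The image of [mu] under the shift and [mu] itself agree on cylinders, hence on all measurable
    sets. *)
Lemma invariant_stationary mu : (forall w, \sum_a mass mu (a :: w) = mass mu w) ->
  invariant mu.
Proof.
move=> sm B mB.
apply: (@eq_mass (distribution mu shift) mu) => //; last first.
  by rewrite (_ : _ setT = 1%E) ?ltry//; exact: (probability_setT (distribution mu shift)).
move=> n w; have := mass_shift mu w; rewrite sm -mu_mass size_tuple -cylE => h.
exact: h.
Qed.

End ShiftBasics.

(** * The measure with prescribed cylinder masses *)

Section Coding.
Context {R : realType} {A : finType} {a0 : A}.
Local Notation X := (ShiftSpace a0).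
Variable m : seq A -> R.
Hypothesis mc : consistent m.

Let m0 w : 0 <= m w. Proof. by case: mc. Qed.

Definition below (p : seq A) (k : nat) : R :=
  \sum_(b | (enum_rank b < k)%N) m (rcons p b).

(** [p] is the prefix already read. The slots of the words of a given length tile [[0, 1[] in
    lexicographic order, and those of the children of a word tile its own slot. *)
Fixpoint left_end (p w : seq A) : R :=
  if w is a :: w' then below p (enum_rank a) + left_end (rcons p a) w' else 0.

Definition slot (w : seq A) : interval R :=
  `[left_end [::] w, left_end [::] w + m w[.

Lemma left_end_rcons p w a :
  left_end p (rcons w a) = left_end p w + below (p ++ w) (enum_rank a).
Proof.
elim: w p => [|b w IH] p /=; first by rewrite cats0 addr0 add0r.
by rewrite IH addrA cat_rcons.
Qed.

Lemma belowS p a :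
  below p (enum_rank a).+1 = below p (enum_rank a) + m (rcons p a).
Proof.
rewrite /below (bigD1 a)//= addrC; congr (_ + _); apply: eq_bigl => b.
by rewrite ltnS ltn_neqAle andbC -(inj_eq enum_rank_inj).
Qed.

Lemma below_le p i j : (i <= j)%N -> below p i <= below p j.
Proof.
move=> ij; rewrite /below [leRHS]big_mkcond/= [leLHS]big_mkcond/=.
apply: ler_sum => b _; case: ltnP => // bi; first by rewrite (leq_trans bi ij).
by case: ifP.
Qed.

Lemma below0 p : below p 0 = 0. Proof. by rewrite /below big_pred0. Qed.

Lemma below_card p : below p #|A| = m p.
Proof. by case: mc => _ _ <-; apply: eq_bigl => b; rewrite ltn_ord. Qed.

Lemma in_slot_rcons w a u : (u \in slot (rcons w a)) =
  (left_end [::] w + below w (enum_rank a) <= u <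
   left_end [::] w + below w (enum_rank a).+1).
Proof. by rewrite /slot in_itv/= left_end_rcons/= belowS addrA. Qed.

Lemma sub_slot_rcons w a u : u \in slot (rcons w a) -> u \in slot w.
Proof.
rewrite in_slot_rcons in_itv/= => /andP[h1 h2].
have := below_le w (leq0n (enum_rank a)); rewrite below0 => h3.
have := @below_le w (enum_rank a).+1 #|A| (ltn_ord _); rewrite below_card => h4.
by apply/andP; split; lra.
Qed.

Lemma slot_rcons_ex w u : u \in slot w -> exists a, u \in slot (rcons w a).
Proof.
rewrite in_itv/= => /andP[h1 h2].
(* The child containing [u] is the predecessor of the first rank whose cumulated mass passes [u]. *)
pose Q k := u < left_end [::] w + below w k.
have exQ : exists k, Q k by exists #|A|; rewrite /Q below_card.
case: (ex_minnP exQ) => -[|k] Qk minQ.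
  by move: Qk; rewrite /Q below0 addr0 ltNge h1.
have kA : (k < #|A|)%N by apply: minQ; rewrite /Q below_card.
exists (enum_val (Ordinal kA)); rewrite in_slot_rcons enum_valK/= -/(Q k.+1) Qk andbT.
by rewrite leNgt; apply/negP => /minQ; rewrite ltnn.
Qed.

Lemma slot_rcons_inj w a b u :
  u \in slot (rcons w a) -> u \in slot (rcons w b) -> a = b.
Proof.
rewrite !in_slot_rcons => /andP[h1 h2] /andP[h3 h4].
apply: enum_rank_inj; apply/val_inj/eqP; rewrite eqn_leq/=.
by apply/andP; split; rewrite leqNgt; apply/negP => /(below_le w); lra.
Qed.

Lemma slot_nil : slot [::] = `[0, 1[.
Proof. by rewrite /slot /=; case: mc => _ -> _; rewrite add0r. Qed.

Definition letter (w : seq A) (u : R) : A :=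
  odflt a0 [pick a | u \in slot (rcons w a)].

Fixpoint code_prefix (n : nat) (u : R) : seq A :=
  if n is n'.+1 then rcons (code_prefix n' u) (letter (code_prefix n' u) u) else [::].

Definition code (u : measurableTypeR R) : X := fun n => letter (code_prefix n u) u.

Lemma pre_code n u : pre n (code u) = code_prefix n u.
Proof. by elim: n => //= n IH; rewrite preS IH. Qed.

Lemma code_slot n u : u \in `[0, 1[ -> forall w, size w = n ->
  (pre n (code u) == w) = (u \in slot w).
Proof.
move=> u01; rewrite pre_code; elim: n => [|n IH] w.
  by move/size0nil ->; rewrite slot_nil u01.
case/lastP: w => // w a; rewrite size_rcons => -[sw] /=.
rewrite eqseq_rcons IH//.
have [uw|uw] := boolP (u \in slot w); last first.
  by apply/esym/negbTE; apply: contra uw; exact: sub_slot_rcons.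
have /eqP -> : code_prefix n u == w by rewrite IH.
rewrite /= /letter; case: pickP => [b ub|no] /=.
  by apply/eqP/idP => [<-//|ua]; exact: slot_rcons_inj ub ua.
by have [b] := slot_rcons_ex uw; rewrite no.
Qed.

Lemma sub_slot w u : u \in slot w -> u \in `[0, 1[.
Proof.
elim/last_ind: w => [|w a IH]; first by rewrite slot_nil.
by move/sub_slot_rcons.
Qed.

Lemma code_out u : u \notin `[0, 1[ -> code u = fun=> a0.
Proof.
move=> u01; apply/funext => n; rewrite /code /letter; case: pickP => //= a /sub_slot.
by rewrite (negbTE u01).
Qed.

Lemma measurable_code : measurable_fun [set: measurableTypeR R] (code : _ -> X).
Proof.
apply: (@measurability _ _ _ X setT code (cylinders a0)) => //.
move=> _ [_ [n [w ->]] <-]; rewrite setTI.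
(* Outside [[0, 1[] no slot is ever picked and the code is the constant default sequence, so the
   preimage has a second part, all or nothing. *)
have -> : code @^-1` cyl a0 w =
    [set` slot w] `|` ((fun=> cyl a0 w (fun=> a0)) `&` ~` [set` `[0, 1[ ]).
  apply/seteqP; split => u; rewrite /preimage /=.
    have [u01|u01] := boolP (u \in `[0, 1[).
      by rewrite cylE/= => /eqP; rewrite code_slot ?size_tuple//; left.
    by rewrite code_out// => h; right; split => //; exact/negP.
  move=> [uw|[h /negP u01]]; last by rewrite code_out.
  by rewrite cylE/=; apply/eqP; rewrite code_slot ?size_tuple// (sub_slot uw).
apply: measurableU; first exact: measurable_itv.
apply: measurableI; last by apply: measurableC; exact: measurable_itv.
have [h|h] := pselect (cyl a0 w (fun=> a0)).
  by rewrite (_ : (fun=> _) = setT)//; apply/seteqP; split.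
by rewrite (_ : (fun=> _) = set0)//; apply/seteqP; split.
Qed.

HB.instance Definition _ :=
  isMeasurableFun.Build _ _ (measurableTypeR R) X code measurable_code.

(** The law of [code] under Lebesgue measure on [[0, 1[]: the numbers whose code begins with [w]
    fill the slot of [w], of length [m w]. *)
Lemma probability_of_consistent : exists mu : probability X R, mass mu = m.
Proof.
have mD : measurable ([set` `[0, 1[ ] : set (measurableTypeR R)) by exact: measurable_itv.
pose P := mrestr (@lebesgue_measure R) mD.
have P1 : P setT = 1%E.
  by rewrite /P /mrestr setTI lebesgue_measure_itv/= lte01 oppr0 adde0.
pose PP : probability (measurableTypeR R) R :=
  HB.pack P (Measure_isProbability.Build _ _ _ P P1).
exists (distribution PP code); apply/funext => w; apply: EFin_inj; rewrite -mu_mass.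
rewrite /= /distribution /pushforward /= /P /mrestr.
have -> : code @^-1` [set x | pre (size w) x = w] `&` [set` `[0, 1[ ] = [set` slot w].
  apply/seteqP; split => u /=.
    by move=> [/eqP + u01]; rewrite code_slot.
  by move=> uw; split; [apply/eqP; rewrite code_slot//|]; exact: sub_slot uw.
rewrite lebesgue_measure_itv/= lte_fin ltrDl.
case: ltP => h; first by rewrite -EFinB addrAC subrr add0r.
by congr EFin; apply/eqP; rewrite eq_le m0 h.
Qed.

End Coding.

(** * The metric and the language of a subshift *)

Section Metric.
Context {R : realType} {A : finType} {a0 : A}.
Local Notation X := (ShiftSpace a0).
Implicit Types (x y : X) (mu : probability X R).

Lemma first_diffP x y : x <> y ->
  x (first_diff x y) <> y (first_diff x y) /\
  pre (first_diff x y) x = pre (first_diff x y) y.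
Proof.
move=> xy; suff: [set n | x n <> y n /\ forall i, (i < n)%N -> x i = y i] !=set0.
  by move=> /(@xgetPex _ 0%N)[h1 h2]; split => //; apply/eq_pre.
have exQ : exists n, x n != y n.
  apply: contrapT => h; apply: xy; apply/funext => n; apply/eqP.
  by apply: contra_notT h => ne; exists n.
case: (ex_minnP exQ) => n xn mn; exists n; split; first exact/eqP.
by move=> i ilt; apply/eqP; rewrite -[_ == _]negbK; apply/negP => /mn; rewrite leqNgt ilt.
Qed.

Lemma dist_lt n x y : (dist x y < (2^-1 : R) ^+ n) -> pre n x = pre n y.
Proof.
rewrite /dist; case: asboolP => [->//|xy].
have [_ h] := first_diffP xy.
rewrite ltr_iXn2l// ?invr_gt0// ?invf_lt1 ?ltr1n// => /ltnW nf.
by rewrite -(take_pre x nf) h take_pre.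
Qed.

Lemma dist_le n x y : pre n x = pre n y -> (dist x y <= (2^-1 : R) ^+ n).
Proof.
move=> e; rewrite /dist; case: asboolP => [xy|xy]; first by rewrite exprn_ge0// invr_ge0.
have [h _] := first_diffP xy.
rewrite ler_iXn2l// ?invr_gt0// ?invf_lt1 ?ltr1n// leqNgt; apply/negP => ilt.
by apply: h; have /eq_pre/(_ _ ilt) := e.
Qed.

Lemma exp_half_lt (e : R) : 0 < e -> exists n : nat, (2^-1 : R) ^+ n < e.
Proof.
move=> e0; have := @cvg_geometric R 1 2^-1.
rewrite ger0_norm ?invr_ge0// invf_lt1 ?ltr1n// => /(_ isT).
move=> /cvgrPdist_lt/(_ _ e0)[N _ /(_ N (leqnn N))] /=.
by rewrite /geometric/= mul1r sub0r normrN ger0_norm ?exprn_ge0 ?invr_ge0//; exists N.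
Qed.

Lemma dcontinuous_pre n (f : seq A -> R) : dcontinuous (fun x : X => f (pre n x)).
Proof.
move=> x e e0; exists (2^-1 ^+ n); first by rewrite exprn_gt0// invr_gt0.
by move=> y /dist_lt ->; rewrite subrr normr0.
Qed.

End Metric.

(** * Language, exit index and word counts of a subshift *)

Section Language.
Context {R : realType} {A : finType} {a0 : A}.
Local Notation X := (ShiftSpace a0).
Implicit Types (x y : X) (mu : probability X R).
Variable X0 : set X.
Hypothesis sX0 : @is_subshift R A a0 X0.

Definition lang (w : seq A) := exists x, X0 x /\ pre (size w) x = w.

Lemma lang_cat u v : lang (u ++ v) -> lang u /\ lang v.
Proof.
have iterX0 k x : X0 x -> X0 (iter k shift x).
  by move=> h; elim: k => // k; have [_ [+ _]] := sX0; exact.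
move=> [x [x0]]; rewrite size_cat pre_cat => /eqP.
rewrite eqseq_cat ?size_pre// => /andP[/eqP h1 /eqP h2].
by split; [exists x|exists (iter (size u) shift x); split => //; exact: iterX0].
Qed.

Lemma lang_pre x m n : (m <= n)%N -> lang (pre n x) -> lang (pre m x).
Proof. by move=> mn; rewrite -(subnKC mn) pre_cat => /lang_cat[]. Qed.

Lemma lang_nil : lang [::].
Proof. by have [[x x0] _] := sX0; exists x. Qed.

Lemma lang_closed x : (forall n, lang (pre n x)) -> X0 x.
Proof.
move=> h; have [_ [_]] := sX0; apply => e e0.
have [n ne] := exp_half_lt e0; have [y [y0 /esym]] := h n; rewrite size_pre => yx.
by exists y; split => //; apply: le_lt_trans ne; exact: dist_le.
Qed.

Lemma lang_X0 x n : X0 x -> lang (pre n x).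
Proof. by exists x; rewrite size_pre. Qed.

(** A point of [X0] sharing the prefix of length [j] gives the upper bound; any closer point would
    put the next prefix into the language. *)
Lemma dist_set_exit x : ~ X0 x ->
  exists j, [/\ lang (pre j x), ~ lang (pre j.+1 x) & dist_set x X0 = (2^-1 : R) ^+ j].
Proof.
move=> nx; have exQ : exists n, ~~ `[< lang (pre n x) >].
  apply: contrapT => h; apply/nx/lang_closed => n; apply/asboolP.
  by apply: contra_notT h => hn; exists n.
case: (ex_minnP exQ) => -[|j] /asboolP nj minj; first by case: nj; exact: lang_nil.
exists j; have lj : lang (pre j x).
  by apply/asboolP; rewrite -[asbool _]negbK; apply/negP => /minj; rewrite ltnn.
split => //; have [y [y0]] := lj; rewrite size_pre => yx.
apply/eqP; rewrite eq_le; apply/andP; split.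
  apply: (@le_trans _ _ (dist x y)); last exact/dist_le/esym.
  apply: ge_inf; last by exists y.
  by exists 0 => _ [z _ <-]; rewrite /dist; case: asboolP => // _.
apply: lb_le_inf; first by exists (dist x y), y.
move=> _ [z z0 <-]; rewrite leNgt; apply/negP => h; apply: nj.
have xz : x <> z by move=> e; apply: nx; rewrite e.
move: h; rewrite /dist; case: asboolP => // _; have [_ e] := first_diffP xz.
rewrite ltr_iXn2l// ?invr_gt0// ?invf_lt1 ?ltr1n// => /lang_pre; apply.
by rewrite e; exact: lang_X0.
Qed.

Definition Ncard n : R := #|language n X0|%:R.

Lemma NcardE n : Ncard n = \sum_(w : n.-tuple A) (`[< lang w >])%:R.
Proof.
rewrite /Ncard -sum1_card natr_sum big_mkcond; apply: eq_bigr => w _.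
rewrite inE; have -> : `[< exists x, X0 x /\ cyl a0 w x >] = `[< lang w >].
  by apply: asbool_equiv_eq; split => -[x [x0 h]]; exists x; split => //;
    move: h; rewrite cylE/= size_tuple.
by case: asbool.
Qed.

Lemma Ncard_ge1 n : 1 <= Ncard n.
Proof.
rewrite NcardE; have [[x x0] _] := sX0.
have s : size (pre n x) == n by rewrite size_pre.
rewrite (bigD1 (Tuple s))//= asboolT; last exact: lang_X0.
by rewrite lerDl sumr_ge0.
Qed.

Lemma Ncard_mul m n : Ncard (m + n) <= Ncard m * Ncard n.
Proof.
rewrite !NcardE (sumw_cat _ _ (fun w => (`[< lang w >])%:R)) mulr_suml.
apply: ler_sum => u _; rewrite mulr_sumr; apply: ler_sum => v _.
case: asboolP => [/lang_cat[h1 h2]|_]; last by rewrite mulr_ge0.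
by rewrite !asboolT// mulr1.
Qed.

Lemma ln_Ncard_ge0 n : 0 <= ln (Ncard n).
Proof. by rewrite ln_ge0// Ncard_ge1. Qed.

Lemma ln_Ncard_subadditive m n : ln (Ncard (m + n)) <= ln (Ncard m) + ln (Ncard n).
Proof.
have h k : 0 < Ncard k by rewrite (lt_le_trans ltr01)// Ncard_ge1.
by rewrite -lnM ?posrE// ler_ln ?posrE ?mulr_gt0// Ncard_mul.
Qed.

Lemma htop_cvg : (fun n => ln (Ncard n) / n%:R) @ \oo --> (htop X0 : R).
Proof. by have [] := fekete ln_Ncard_ge0 ln_Ncard_subadditive. Qed.

Lemma htop_le n : (0 < n)%N -> htop X0 * n%:R <= ln (Ncard n).
Proof.
move=> n0; have [_ h] := fekete ln_Ncard_ge0 ln_Ncard_subadditive.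
by rewrite -ler_pdivlMr ?ltr0n//; exact: h.
Qed.

Lemma htop_ge0 : 0 <= (htop X0 : R).
Proof.
apply: limr_ge; first by apply/cvg_ex; exists (htop X0 : R); exact: htop_cvg.
by apply: nearW => n; rewrite divr_ge0// ln_Ncard_ge0.
Qed.

Lemma kappa_ge0 i : 0 <= (kappa X0 i : R).
Proof.
by rewrite subr_ge0 ler_pdivlMr ?ltr0n ?expn_gt0// htop_le// expn_gt0.
Qed.

Lemma kappa_small (e : R) : 0 < e -> exists K0, forall K, (K0 <= K)%N -> (kappa X0 K : R) < e.
Proof.
move=> e0; have /cvgrPdist_lt/(_ _ e0)[N _ h] := htop_cvg.
exists N => K NK; have := h (2 ^ K)%N; rewrite /= => /(_ _).
rewrite distrC => h'; apply: le_lt_trans (ler_norm _) (h' _).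
by rewrite (leq_trans NK)// ltnW// ltn_expl.
Qed.

Lemma Ncard_exp2 i :
  Ncard (2 ^ i) = expR ((2 ^ i)%:R * htop X0 + (2 ^ i)%:R * kappa X0 i).
Proof.
have N0 : 0 < Ncard (2 ^ i) by rewrite (lt_le_trans ltr01)// Ncard_ge1.
rewrite -[LHS]lnK ?posrE//; congr expR; rewrite /kappa -/(Ncard _).
by field; rewrite pnatr_eq0 -lt0n expn_gt0.
Qed.

End Language.

(** * Integrals of functions of finitely many letters *)

Section Integrals.
Context {R : realType} {A : finType} {a0 : A}.
Local Notation X := (ShiftSpace a0).
Implicit Types (mu : probability X R) (psi : X -> R).
Local Open Scope ereal_scope.

Lemma measurable_fun_pre n (g : seq A -> R) :
  measurable_fun setT (fun x : X => g (pre n x)).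
Proof. by move=> _ B mB; rewrite setTI; exact: (@measurable_pre _ _ n (g @^-1` B)). Qed.

Lemma integral_pre mu n (g : seq A -> R) : (forall w, 0 <= g w)%R ->
  \int[mu]_x (g (pre n x))%:E = (\sum_(w : n.-tuple A) mass mu w * g w)%:E.
Proof.
move=> g0.
have E x : (g (pre n x))%:E =
    \sum_(w <- index_enum (n.-tuple A : finType)) (g w)%:E * (\1_(cyl a0 w) x)%:E.
  have s : size (pre n x) == n by rewrite size_pre.
  rewrite (bigD1 (Tuple s))//= big1 => [|w wx].
    by rewrite indicE mem_set ?mule1 ?adde0// cylE.
  rewrite indicE memNset ?mule0// cylE/= => e; move/eqP: wx; apply; exact: val_inj.
under eq_integral => x _ do rewrite E.
rewrite ge0_integral_sum//; last 2 first.
- by move=> w; apply/measurable_EFinP/measurable_funM => //; apply/measurable_indicP; exact: measurable_cyl.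
- by move=> w x _; rewrite mule_ge0// lee_fin.
rewrite -sumEFin; apply: eq_bigr => w _.
rewrite ge0_integralZl_EFin//; last first.
  by apply/measurable_EFinP/measurable_indicP; exact: measurable_cyl.
rewrite integral_indic//; last exact: measurable_cyl.
by rewrite setIT mulrC EFinM; congr (_ * _); exact: mu_cyl.
Qed.

Lemma integral_shift mu psi : invariant mu -> measurable_fun setT psi ->
  (forall x, 0 <= psi x)%R -> \int[mu]_x (psi (shift x))%:E = \int[mu]_x (psi x)%:E.
Proof.
move=> imu mpsi psi0.
have := @ge0_integral_pushforward _ _ X X R shift measurable_shift mu setT
  (fun x => (psi x)%:E) measurableT.
rewrite preimage_setT => /(_ _ _)/= <-.
- by apply: eq_measure_integral => B mB _; rewrite -[RHS]imu.
- exact/measurable_EFinP.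
- by move=> x _; rewrite lee_fin.
Qed.

Lemma integral_iter_shift mu psi s : invariant mu -> measurable_fun setT psi ->
  (forall x, 0 <= psi x)%R ->
  \int[mu]_x (psi (iter s shift x))%:E = \int[mu]_x (psi x)%:E.
Proof.
move=> imu mpsi psi0; elim: s => //= s <-.
under eq_integral => x _ do rewrite -/(iter s.+1 shift x) iterSr.
apply: (@integral_shift _ (psi \o iter s shift)) => //; last by move=> x; exact: psi0.
exact: measurableT_comp (measurable_iter_shift s).
Qed.

Lemma integral_bounded mu psi M : (forall x, 0 <= psi x <= M)%R ->
  measurable_fun setT psi -> \int[mu]_x (psi x)%:E \is a fin_num.
Proof.
move=> h mpsi; rewrite ge0_fin_numE; last first.
  by apply: integral_ge0 => x _; rewrite lee_fin; case/andP: (h x).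
apply: (@le_lt_trans _ _ (\int[mu]_x (cst M%:E x))).
  apply: ge0_le_integral => //=.
  - by move=> x _; rewrite lee_fin; case/andP: (h x).
  - exact/measurable_EFinP.
  - by move=> x _; rewrite lee_fin; case/andP: (h x).
by rewrite integral_cst// (_ : _ setT = 1) ?mule1 ?ltry//; exact: probability_setT.
Qed.

(** Integrate the pointwise bound; by invariance every term of the Birkhoff sum contributes the same
    integral. *)
Lemma sum_mass_le_integral mu psi n (G : seq A -> R) (beta : R) : invariant mu ->
  measurable_fun setT psi -> (forall x, 0 <= psi x)%R ->
  \int[mu]_x (psi x)%:E \is a fin_num -> (0 <= beta)%R ->
  (forall x, - (G (pre n x)) <= beta * \sum_(0 <= s < n) psi (iter s shift x))%R ->
  (- \sum_(w : n.-tuple A) mass mu w * G w <= beta * (n%:R * fine (\int[mu]_x (psi x)%:E)))%R.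
Proof.
move=> imu mpsi psi0 fpsi beta0 h.
(* Adding [M] makes the integrands nonnegative; it cancels at the end because the masses sum to
   1. *)
pose M : R := (\sum_(w : n.-tuple A) `|G w|)%R.
have GM (x : X) : (G (pre n x) <= M)%R.
  have s : size (pre n x) == n by rewrite size_pre.
  rewrite (le_trans (ler_norm _))// /M (bigD1 (Tuple s))//= lerDl sumr_ge0//.
(* The truncation changes nothing on prefixes of length [n]; it makes [g] nonnegative on all lists,
   as [integral_pre] asks. *)
pose g (w : seq A) : R := Num.max 0%R (M - G w)%R.
have gE (x : X) : g (pre n x) = (M - G (pre n x))%R by rewrite /g max_r// subr_ge0.
have M0 : (0 <= M)%R by rewrite sumr_ge0.
have gle (x : X) : (g (pre n x) <= beta * \sum_(0 <= s < n) psi (iter s shift x) + M)%R.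
  by rewrite gE; have := h x; lra.
have mpi i : measurable_fun setT (fun x : X => psi (iter i shift x)).
  exact: measurableT_comp mpsi (measurable_iter_shift i).
have S0 (x : X) : (0 <= \sum_(0 <= s < n) psi (iter s shift x))%R by rewrite sumr_ge0.
have mS : measurable_fun setT (fun x : X => \sum_(0 <= s < n) psi (iter s shift x))%R.
  exact: measurable_sum.
have E : (\sum_(w : n.-tuple A) mass mu w * g w)%:E = \int[mu]_x (g (pre n x))%:E.
  by rewrite integral_pre// => w; rewrite /g le_max lexx.
have I2 : \int[mu]_x (g (pre n x))%:E <=
    \int[mu]_x (beta%:E * (\sum_(0 <= s < n) psi (iter s shift x))%:E + M%:E).
  apply: ge0_le_integral => //.
  - by move=> x _; rewrite lee_fin /g le_max lexx.
  - by apply/measurable_EFinP; exact: (measurable_fun_pre n g).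
  - apply: emeasurable_funD => //; apply/measurable_EFinP; exact: measurable_funM.
  - by move=> x _; rewrite -EFinM -EFinD lee_fin gle.
have I3 : \int[mu]_x (beta%:E * (\sum_(0 <= s < n) psi (iter s shift x))%:E + M%:E) =
    (beta * (n%:R * fine (\int[mu]_x (psi x)%:E)) + M)%:E.
  rewrite ge0_integralD//; last 2 first.
  - by move=> x _; rewrite -EFinM lee_fin mulr_ge0.
  - by apply/measurable_EFinP; exact: measurable_funM.
  rewrite integral_cst// ge0_integralZl_EFin//; last 2 first.
  - by move=> x _; rewrite lee_fin.
  - exact/measurable_EFinP.
  have -> : \int[mu]_x (\sum_(0 <= s < n) psi (iter s shift x))%:E =
      \int[mu]_x (\sum_(0 <= s < n) (psi (iter s shift x))%:E).
    by apply: eq_integral => x _; rewrite sumEFin.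
  rewrite ge0_integral_sum//; last 2 first.
  - by move=> i; exact/measurable_EFinP.
  - by move=> i x _; rewrite lee_fin.
  rewrite (eq_bigr (fun=> (fine (\int[mu]_x (psi x)%:E))%:E)); last first.
    by move=> i _; rewrite fineK// integral_iter_shift.
  rewrite sumEFin sumr_const_nat subn0 (_ : _ setT = 1); last exact: probability_setT.
  by rewrite mule1 -EFinM -EFinD mulr_natl.
move: I2; rewrite I3 -E lee_fin => I2.
have : (\sum_(w : n.-tuple A) mass mu w * (M - G w) <= \sum_(w : n.-tuple A) mass mu w * g w)%R.
  apply: ler_sum => w _; rewrite ler_wpM2l//; first by have [] := mass_consistent mu.
  by rewrite /g le_max lexx orbT.
have -> : (\sum_(w : n.-tuple A) mass mu w * (M - G w) = M - \sum_(w : n.-tuple A) mass mu w * G w)%R.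
  under eq_bigr => w _ do rewrite mulrBr.
  by rewrite sumrB -mulr_suml consistent_sum ?mul1r//; exact: mass_consistent.
lra.
Qed.

End Integrals.

(** * The pressure bound *)

Section Potential.
Context {R : realType} {A : finType} {a0 : A}.
Local Notation X := (ShiftSpace a0).
Implicit Types (x y : X) (mu : probability X R).
Variables (X0 : set X) (a : nat -> R) (phi : X -> R).
Hypothesis sX0 : @is_subshift R A a0 X0.
Hypothesis a_noninc : forall i j, (i <= j)%N -> a j <= a i.
Hypothesis a_ge : forall j : nat, (0 < j)%N ->
     2 * ln (j%:R) / j%:R
     + j%:R^-1 * (\sum_(0 <= i < (trunc_log 2 j).+1) (2 ^ i)%:R * kappa X0 i)
     + j%:R^-1 <= a (3 * j)%N.
Hypothesis phi_X0 : forall x, X0 x -> phi x = 0.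
Hypothesis phi_out : forall x (j : nat), ~ X0 x ->
  dist_set x X0 = (2^-1 : R) ^+ j -> phi x = - a j.

Let h : R := htop X0.
Let f i : R := (2 ^ i)%:R * kappa X0 i.
Let S q : R := \sum_(0 <= i < q) f i.
(** The right-hand side of the hypothesis at [j = 2 ^ p], multiplied by [2 ^ p]; the integer
    logarithm is then exactly [p]. *)
Let B p : R := 2 * (p%:R * ln 2) + S p.+1 + 1.

Let f_ge0 i : 0 <= f i. Proof. by rewrite mulr_ge0// kappa_ge0. Qed.
Let S_ge0 q : 0 <= S q. Proof. by rewrite sumr_ge0. Qed.
Let SS q : S q.+1 = S q + f q. Proof. by rewrite /S big_nat_recr. Qed.
Let ln2_ge0 : 0 <= ln (2 : R). Proof. by rewrite ln_ge0// ler1n. Qed.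

Let B_le p : B p <= (2 ^ p)%:R * a (3 * 2 ^ p)%N.
Proof.
have p0 : (0 < 2 ^ p)%N by rewrite expn_gt0.
have := a_ge p0; rewrite trunc_expnK// -(@ler_pM2l _ (2 ^ p)%:R) ?ltr0n//.
apply: le_trans; rewrite natrX lnXn// -[ln 2 *+ p]mulr_natl le_eqVlt; apply/orP; left.
by rewrite eq_sym; apply/eqP; rewrite /B /S /f; field; rewrite expf_neq0.
Qed.

(** The summand 1/j of the hypothesis makes [a (3 * 2 ^ j)] positive, and monotonicity carries this
    down to index [j]. *)
Lemma weight_gt0 j : 0 < a j.
Proof.
apply: (@lt_le_trans _ _ (a (3 * 2 ^ j)%N)).
  rewrite -(@pmulr_rgt0 _ (2 ^ j)%:R) ?ltr0n ?expn_gt0//.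
  by apply: lt_le_trans (B_le j); rewrite ltr_wpDl// addr_ge0// !mulr_ge0.
by apply: a_noninc; rewrite (leq_trans (ltnW (ltn_expl j (leqnn 2))))// leq_pmull.
Qed.

Lemma phi_exit m x : ~ lang X0 (pre m x) -> phi x <= - a m.
Proof.
move=> nl; have nx : ~ X0 x by move=> h0; apply/nl/(lang_X0 m h0).
have [j [lj _ ej]] := dist_set_exit sX0 nx.
rewrite (phi_out nx ej) lerN2 a_noninc// leqNgt; apply/negP => jm; apply: nl.
exact: (lang_pre sX0 (ltnW jm) lj).
Qed.

Lemma phi_bad x : ~ lang X0 (pre 1 x) -> phi x = - a 0%N.
Proof.
move=> nl; have nx : ~ X0 x by move=> h0; apply/nl/(lang_X0 1 h0).
have [[|j] [lj _ ej]] := dist_set_exit sX0 nx; first exact: phi_out ej.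
by case: nl; exact: (lang_pre sX0 _ lj).
Qed.

Lemma phi_le0 x : phi x <= 0.
Proof.
have [/phi_X0->//|nx] := pselect (X0 x).
have [j [_ _ ej]] := dist_set_exit sX0 nx.
by rewrite (phi_out nx ej) oppr_le0 ltW// weight_gt0.
Qed.

Lemma phi_ge x : - a 0%N <= phi x.
Proof.
have [/phi_X0->//|nx] := pselect (X0 x); first by rewrite oppr_le0 ltW// weight_gt0.
have [j [_ _ ej]] := dist_set_exit sX0 nx.
by rewrite (phi_out nx ej) lerN2 a_noninc.
Qed.

Definition birk n y : R := \sum_(0 <= s < n) phi (iter s shift y).

Lemma birkD m n y : birk (m + n) y = birk m y + birk n (iter m shift y).
Proof.
rewrite /birk (big_cat_nat _ (leq_addr n m))//=; congr (_ + _).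
rewrite -{1}[m]add0n big_addn addKn; apply: eq_bigr => i _.
by rewrite iterD.
Qed.

Lemma birk_le0 n y : birk n y <= 0.
Proof. by rewrite /birk sumr_le0// => i _; exact: phi_le0. Qed.

(** * Weighted sums over parses *)

Section Parsing.
Variables (K : nat) (beta : R).
(** The constant [12^-1] is 1/3 (one step of [th]) times 1/4 (the share allowed to [pay]); [2^-1] is
    the half of [th 0] left for a bad letter. The bound [1 <= beta] keeps the full excess in each
    payment. *)
Hypothesis beta_ge1 : 1 <= beta.
Hypothesis beta_exp : expR (- beta) <= 12^-1.
Hypothesis beta_bad : #|A|%:R * expR (- (beta * a 0%N)) <= 2^-1.

Let beta_ge0 : 0 <= beta. Proof. exact: le_trans beta_ge1. Qed.

(* q is one plus the scale of the piece just read, or 0 if there is none; the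
   piece pays once the next piece is not longer.  Scale K is capped: a piece of
   that scale need not be maximal, so no payment can be certified before it. *)
Definition toll q i : R :=
  if (q <= i)%N || (i == K) then 1 else expR (- (beta * B q.-1)).

(** A letter outside the language is a piece by itself: it settles any pending payment, costs [a 0],
    and resets the state to 0. *)
Definition toll_bad q : R :=
  (if q == 0%N then 1 else expR (- (beta * B q.-1))) * expR (- (beta * a 0%N)).

(** The greedy parse is one term among all parses; summing over all of them lets the sum over words
    factor piece by piece. A tail shorter than [2 ^ K] is left unparsed, so every scale up to [K]
    fits. *)
Fixpoint parse_weight (fuel q : nat) (w : seq A) : R :=
  if fuel is fuel'.+1 then
    if (size w < 2 ^ K)%N then 1 else
      \sum_(i < K.+1) (`[< lang X0 (take (2 ^ i) w) >])%:R * toll q i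
          * parse_weight fuel' i.+1 (drop (2 ^ i) w)
      + toll_bad q * parse_weight fuel' 0 (drop 1 w)
  else 1.

Lemma toll_gt0 q i : 0 < toll q i.
Proof. by rewrite /toll; case: ifP; rewrite ?expR_gt0. Qed.

Lemma toll_bad_gt0 q : 0 < toll_bad q.
Proof. by rewrite /toll_bad mulr_gt0 ?expR_gt0//; case: ifP; rewrite ?expR_gt0. Qed.

Lemma parse_weight_ge0 fuel q w : 0 <= parse_weight fuel q w.
Proof.
elim: fuel q w => //= n IH q w; case: ifP => // _.
apply: addr_ge0; last by rewrite mulr_ge0 ?IH// ltW// toll_bad_gt0.
by apply: sumr_ge0 => i _; rewrite !mulr_ge0 ?IH// ltW// toll_gt0.
Qed.

Definition last_len q := if q is p.+1 then (2 ^ p)%N else 0%N.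

(** A word starting inside the piece and ending with the missing word has length at most
    [2 ^ p + 2 ^ p.+1 = 3 * 2 ^ p]; hence the index 3j in the hypothesis. *)
Lemma birk_last p m y : (m <= 2 ^ p.+1)%N ->
  ~ lang X0 (pre m (iter (2 ^ p) shift y)) -> birk (2 ^ p) y <= - B p.
Proof.
move=> mp nl.
apply: (@le_trans _ _ (\sum_(0 <= s < 2 ^ p) - a (3 * 2 ^ p)%N)).
  rewrite /birk !big_nat; apply: ler_sum => s /= sp.
  apply: (@le_trans _ _ (- a (2 ^ p - s + m)%N)).
    apply: phi_exit; rewrite pre_cat -iterD subnK; last exact: ltnW.
    by move=> /(lang_cat sX0)[].
  rewrite lerN2 a_noninc//; rewrite expnS in mp; lia.
rewrite sumr_const_nat subn0 mulNrn lerN2 -mulr_natl; exact: B_le.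
Qed.

(** The Birkhoff sum includes the piece just read, since only the next piece certifies its payment;
    this is the offset [last_len q]. *)
Lemma parse_weight_ge fuel q y n : (n <= fuel)%N ->
  expR (beta * birk (last_len q + n) y) <=
  parse_weight fuel q (pre n (iter (last_len q) shift y)).
Proof.
elim: fuel q y n => [|fuel IH] q y n nf /=.
  by rewrite -[leRHS]expR0 ler_expR mulr_ge0_le0// birk_le0.
rewrite size_pre; case: ltnP => nK.
  by rewrite -[leRHS]expR0 ler_expR mulr_ge0_le0// birk_le0.
set x := iter _ shift y.
rewrite birkD -/x.
have last_le m p : (m <= 2 ^ p.+1)%N -> ~ lang X0 (pre m x) -> q = p.+1 ->
    expR (beta * birk (last_len q) y) <= expR (- (beta * B p)).
  move=> mp nl qp; rewrite ler_expR -mulrN ler_wpM2l// qp; apply: birk_last mp _.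
  by move: nl; rewrite /x qp.
have [l1|nl1] := pselect (lang X0 (pre 1 x)); last first.
  apply: (@le_trans _ _ (toll_bad q * parse_weight fuel 0 (drop 1 (pre n x)))); last first.
    rewrite lerDr sumr_ge0// => i _.
    by rewrite !mulr_ge0// ?parse_weight_ge0// ltW// toll_gt0.
  have n1 : (1 <= n)%N by rewrite (leq_trans _ nK)// expn_gt0.
  rewrite drop_pre// mulrDr expRD.
  have := IH 0%N (shift x) (n - 1)%N; rewrite /= add0n => /(_ _) IH1.
  rewrite -{1}(subnKC n1) birkD mulrDr expRD mulrA.
  apply: ler_pM; rewrite ?mulr_ge0 ?expR_ge0//; last by apply: IH1; lia.
  rewrite /toll_bad; apply: ler_pM; rewrite ?expR_ge0//.
    case: eqP => [->/=|q0]; first by rewrite /birk big_nil mulr0 expR0.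
    apply: (last_le 1%N) => //; first by rewrite expn_gt0.
    by rewrite prednK// lt0n; exact/eqP.
  by rewrite ler_expR -mulrN ler_wpM2l// /birk big_nat1 phi_bad.
(* The greedy scale exists because the single letter is in the language; when it is below [K], its
   maximality supplies the missing word of length [2 ^ i.+1]. *)
pose Q i := (i <= K)%N && `[< lang X0 (pre (2 ^ i) x) >].
have exQ : exists i, Q i by exists 0%N; apply/asboolP.
have bQ i : Q i -> (i <= K)%N by case/andP.
case: (ex_maxnP exQ bQ) => i /andP[iK /asboolP li] maxi.
have ion : (2 ^ i <= n)%N by rewrite (leq_trans _ nK)// leq_exp2l.
apply: (@le_trans _ _ (toll q i * parse_weight fuel i.+1 (drop (2 ^ i) (pre n x)))); last first.
  rewrite (bigD1 (Ordinal (iK : (i < K.+1)%N)))//= take_pre// asboolT// mul1r.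
  rewrite -addrA lerDl addr_ge0//; last by rewrite mulr_ge0 ?parse_weight_ge0// ltW// toll_bad_gt0.
  by rewrite sumr_ge0// => j _; rewrite !mulr_ge0// ?parse_weight_ge0// ltW// toll_gt0.
rewrite drop_pre// mulrDr expRD; apply: ler_pM; rewrite ?expR_ge0//; last first.
  have := IH i.+1 x (n - 2 ^ i)%N; rewrite /= subnKC//; apply.
  by rewrite leq_subLR (leq_trans nf)// -add1n leq_add2r expn_gt0.
rewrite /toll; case: ifPn => [_|].
  by rewrite -[leRHS]expR0 ler_expR mulr_ge0_le0// birk_le0.
rewrite negb_or -ltnNge => /andP[iq ineK].
apply: (last_le (2 ^ i.+1)%N).
- by rewrite leq_exp2l// prednK// (leq_ltn_trans _ iq).
- move=> l; have : (i.+1 <= i)%N; last by rewrite ltnn.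
  by apply: maxi; rewrite /Q ltn_neqAle ineK iK; apply/asboolP.
- by rewrite prednK// (leq_ltn_trans _ iq).
Qed.

(** Supersolution: [expR (- S q)] anticipates the pending payment for the excess of the scales below
    [q], and powers of 1/3 make all longer next pieces together weigh at most half. *)
Let th q : R := expR (- S q) * 3^-1 ^+ q.
(** Chosen so that [expR (f K - 2 ^ K * delta)] is exactly 1/2, the factor for repeating the capped
    scale. *)
Let delta : R := kappa X0 K + ln 2 / (2 ^ K)%:R.

Let th_gt0 q : 0 < th q.
Proof. by rewrite mulr_gt0 ?expR_gt0// exprn_gt0// invr_gt0. Qed.

Let th0 : th 0 = 1. Proof. by rewrite /th /S big_nil oppr0 expR0 mul1r. Qed.

Let S_le p q : (p <= q)%N -> S p <= S q.
Proof.
by move=> pq; rewrite /S (big_cat_nat _ pq)//= lerDl sumr_ge0.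
Qed.

Let th_le p q : (p <= q)%N -> th q <= th p.
Proof.
move=> pq; apply: ler_pM; rewrite ?expR_ge0 ?exprn_ge0 ?invr_ge0//.
  by rewrite ler_expR lerN2 S_le.
by rewrite ler_wiXn2l ?invr_ge0// invf_le1 ?ler1n.
Qed.

Let delta_ge0 : 0 <= delta.
Proof. by rewrite addr_ge0 ?kappa_ge0// divr_ge0. Qed.

Let geo q N : (q <= N)%N ->
  \sum_(q <= i < N) (3^-1 : R) ^+ i.+1 = (3^-1 ^+ q - 3^-1 ^+ N) / 2.
Proof.
move=> qN; rewrite (@telescope_sumr_eq _ _ _ (fun i => - (3^-1 ^+ i) / 2))//; first by ring.
by move=> i _; rewrite exprS; field.
Qed.

Let th_step i : expR (f i) * th i.+1 = expR (- S i) * 3^-1 ^+ i.+1.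
Proof. by rewrite /th mulrA -expRD SS; congr (expR _ * _); ring. Qed.

Let step q i := toll q i * (expR (f i - (2 ^ i)%:R * delta) * th i.+1).

Let step_le q i : step q i <= toll q i * (expR (- S i) * 3^-1 ^+ i.+1).
Proof.
rewrite /step -th_step ler_wpM2l ?(ltW (toll_gt0 _ _))// ler_wpM2r ?(ltW (th_gt0 _))//.
by rewrite ler_expR gerBl mulr_ge0.
Qed.

Let pay q : R := if q == 0%N then 0 else expR (- (beta * B q.-1)).

Let pay_ge0 q : 0 <= pay q. Proof. by rewrite /pay; case: ifP => // _; rewrite expR_ge0. Qed.

(** As [beta >= 1], [beta * B p] is at least [beta] plus the remaining terms of [B p]; then
    [4^-p <= 3^-p] and [beta_exp] finish. *)
Let pay_le q : pay q <= th q / 4.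
Proof.
rewrite /pay; case: q => [|p] /=; first by rewrite divr_ge0// ltW.
have -> : th p.+1 / 4 = 12^-1 * (3^-1 ^+ p * expR (- S p.+1)).
  by rewrite /th exprS; field.
apply: (@le_trans _ _ (expR (- beta) * (4^-1 ^+ p * expR (- S p.+1)))).
  have -> : 4^-1 ^+ p = expR (- (2 * (p%:R * ln 2))) :> R.
    have -> : - (2 * (p%:R * ln 2)) = p%:R * ln (4^-1) :> R.
      by rewrite lnV ?posrE// (_ : 4 = 2 ^+ 2 :> R) ?lnXn//; lra.
    by rewrite expRM_natl lnK ?posrE ?invr_gt0.
  rewrite -!expRD ler_expR.
  have := @ler_wpM2r _ (2 * (p%:R * ln 2) + S p.+1) _ 1 beta.
  rewrite addr_ge0// ?mulr_ge0// => /(_ isT beta_ge1).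
  by rewrite /B; lra.
apply: ler_pM; rewrite ?expR_ge0 ?mulr_ge0 ?expR_ge0 ?exprn_ge0 ?invr_ge0//.
by rewrite ler_wpM2r ?expR_ge0// lerXn2r ?nnegrE ?invr_ge0// lef_pV2 ?posrE// ler_nat.
Qed.

(** Next scales [i >= q] form a geometric series worth [th q / 2]; lower ones all carry the factor
    [pay q]. In state [K.+1] no longer scale exists, and repeating scale [K] contributes the
    half. *)
Let sum_step q : (q <= K.+1)%N -> \sum_(i < K.+1) step q i <= th q / 2 + pay q / 2.
Proof.
move=> qK; rewrite -(big_mkord xpredT (step q)).
have small N : (N <= q)%N -> (N <= K)%N -> \sum_(0 <= i < N) step q i <= pay q / 2.
  move=> Nq NK; apply: (@le_trans _ _ (\sum_(0 <= i < N) pay q * 3^-1 ^+ i.+1)).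
    rewrite !big_nat; apply: ler_sum => i /= iN; apply: le_trans (step_le _ _) _.
    rewrite /toll leqNgt (leq_trans iN Nq)/= ltn_eqF; last exact: leq_trans NK.
    rewrite /pay; case: eqP => [q0|_]; first by move: iN; rewrite ltnNge (leq_trans Nq)// q0.
    by rewrite ler_wpM2l ?expR_ge0// ler_piMl ?exprn_ge0 ?invr_ge0// -[leRHS]expR0 ler_expR oppr_le0.
  rewrite -mulr_sumr geo// ler_wpM2l// -[leRHS]mul1r ler_wpM2r ?invr_ge0// expr0 gerBl.
  by rewrite exprn_ge0// invr_ge0.
move: qK; rewrite leq_eqVlt => /orP[/eqP qK|]; last rewrite ltnS => qK.
  rewrite big_nat_recr//= addrC lerD ?small// ?qK//.
  rewrite /step /toll eqxx orbT mul1r mulrC ler_wpM2l ?(ltW (th_gt0 _))//.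
  rewrite le_eqVlt; apply/orP; left; apply/eqP.
  rewrite -[RHS]lnK ?posrE ?invr_gt0// lnV ?posrE//; congr expR.
  by rewrite /f /delta; field; rewrite pnatr_eq0 -lt0n expn_gt0.
rewrite (big_cat_nat (leq0n q) (leqW qK))/= addrC lerD ?small//.
apply: (@le_trans _ _ (\sum_(q <= i < K.+1) expR (- S q) * 3^-1 ^+ i.+1)).
  rewrite !big_nat; apply: ler_sum => i /andP[qi _]; apply: le_trans (step_le _ _) _.
  rewrite /toll qi/= mul1r ler_wpM2r ?exprn_ge0 ?invr_ge0//.
  by rewrite ler_expR lerN2 S_le.
rewrite -mulr_sumr geo; last exact: leqW.
rewrite /th -mulrA ler_wpM2l ?expR_ge0// ler_wpM2r ?invr_ge0// gerBl.
by rewrite exprn_ge0// invr_ge0.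
Qed.

(** The budget: for [q > 0] the total is at most [th q / 2 + pay q], so 3/4 of [th q]; for [q = 0]
    good pieces and bad letters may take one half each. *)
Let sum_step_bad q : (q <= K.+1)%N ->
  \sum_(i < K.+1) step q i + toll_bad q * #|A|%:R <= th q.
Proof.
move=> qK; have := sum_step qK; have := pay_le q.
have : toll_bad q * #|A|%:R <= (if q == 0%N then 1 else pay q) / 2.
  rewrite /toll_bad /pay -mulrA [_ * #|A|%:R]mulrC; case: ifP => _.
    by rewrite !mul1r.
  by rewrite ler_wpM2l// expR_ge0.
have := pay_ge0 q; have := th_gt0 q.
case: eqP => [->|_]; last by lra.
rewrite th0 /pay/=; lra.
Qed.

(** Pays for the unparsed tail: at most [|A| ^ (2 ^ K)] words, divided by the least value of [th]
    over the states. *)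
Let C : R := #|A|%:R ^+ (2 ^ K) / th K.+1.

(** Cutting off the first piece and counting it with [Ncard_exp2] reduces the induction step to
    [sum_step_bad]. *)
Lemma parse_weight_sum fuel n q : (n <= fuel)%N -> (q <= K.+1)%N ->
  \sum_(w : n.-tuple A) parse_weight fuel q w <= C * th q * expR (n%:R * (h + delta)).
Proof.
have A1 : 1 <= #|A|%:R :> R by rewrite ler1n; apply/card_gt0P; exists a0.
have hd : 0 <= h + delta by rewrite addr_ge0// htop_ge0.
have C0 : 0 <= C by rewrite divr_ge0 ?exprn_ge0// ltW.
have base m p : (m < 2 ^ K)%N -> (p <= K.+1)%N ->
    \sum_(w : m.-tuple A) 1 <= C * th p * expR (m%:R * (h + delta)).
  move=> mK pK; rewrite sumr_const card_tuple natrX.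
  apply: (@le_trans _ _ (#|A|%:R ^+ (2 ^ K))); first by rewrite ler_weXn2l// ltnW.
  rewrite -[leLHS]mulr1 -[C * _ * _]mulrA; rewrite /C -mulrA ler_wpM2l ?exprn_ge0//.
  rewrite mulrA -[leLHS]mulr1 ler_pM//.
    by rewrite ler_pdivlMl// mulr1 th_le.
  by rewrite -[leLHS]expR0 ler_expR mulr_ge0.
elim: fuel n q => [|fuel IH] n q.
  by rewrite leqn0 => /eqP -> qK; apply: base; rewrite // expn_gt0.
move=> nf qK /=; case: (ltnP n (2 ^ K)) => nK.
  apply: le_trans (base _ _ nK qK); apply: ler_sum => w _.
  by rewrite size_tuple nK.
under eq_bigr => w _ do rewrite size_tuple ltnNge nK /=.
rewrite big_split/= exchange_big/= -mulr_sumr.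
apply: (@le_trans _ _ (\sum_(i < K.+1) C * expR (n%:R * (h + delta)) * step q i +
    C * expR (n%:R * (h + delta)) * (toll_bad q * #|A|%:R))); last first.
  by rewrite -mulr_sumr -mulrDr [leRHS]mulrAC ler_wpM2l ?sum_step_bad// mulr_ge0 ?expR_ge0.
apply: lerD.
  apply: ler_sum => i _.
  have ion : (2 ^ i <= n)%N by rewrite (leq_trans _ nK)// leq_exp2l// -ltnS.
  have -> : \sum_(w : n.-tuple A) (`[< lang X0 (take (2 ^ i) w) >])%:R * toll q i *
      parse_weight fuel i.+1 (drop (2 ^ i) w) =
      toll q i * (@Ncard R A a0 X0 (2 ^ i) * \sum_(v : (n - 2 ^ i).-tuple A) parse_weight fuel i.+1 v).
    rewrite (sumw_split (fun w => (`[< lang X0 (take (2 ^ i) w) >])%:R * toll q i *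
      parse_weight fuel i.+1 (drop (2 ^ i) w)) ion) NcardE mulr_suml mulr_sumr.
    apply: eq_bigr => u _; rewrite 2!mulr_sumr; apply: eq_bigr => v _.
    by rewrite take_size_cat ?size_tuple// drop_size_cat ?size_tuple// mulrCA mulrA.
  rewrite /step [leRHS]mulrCA ler_wpM2l ?(ltW (toll_gt0 _ _))//.
  apply: (@le_trans _ _ (Ncard X0 (2 ^ i) * (C * th i.+1 * expR ((n - 2 ^ i)%:R * (h + delta))))).
    rewrite ler_wpM2l//; apply: IH; last exact: ltn_ord.
    by rewrite leq_subLR (leq_trans nf)// -add1n leq_add2r expn_gt0.
  rewrite (Ncard_exp2 sX0) -/h -/(f i) le_eqVlt; apply/orP; left; apply/eqP.
  rewrite natrB// mulrCA [_ * expR (_ * (h + delta))]mulrC.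
  rewrite [X in _ = X](_ : _ = C * th i.+1 * (expR (n%:R * (h + delta)) * expR (f i - (2 ^ i)%:R * delta))); last by ring.
  by congr (_ * _); rewrite -!expRD; congr expR; ring.
rewrite [leRHS]mulrCA ler_wpM2l ?(ltW (toll_bad_gt0 _))//.
have n1 : (1 <= n)%N by rewrite (leq_trans _ nK)// expn_gt0.
rewrite (sumw_split (fun w => parse_weight fuel 0 (drop 1 w)) n1).
apply: (@le_trans _ _ (\sum_(u : 1.-tuple A) C * expR (n%:R * (h + delta)))); last first.
  by rewrite sumr_const card_tuple expn1 mulr_natr.
apply: ler_sum => u _.
have -> : \sum_(v : (n - 1).-tuple A) parse_weight fuel 0 (drop 1 (u ++ v)) =
    \sum_(v : (n - 1).-tuple A) parse_weight fuel 0 v.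
  by apply: eq_bigr => v _; rewrite drop_size_cat ?size_tuple.
apply: le_trans (IH _ _ _ (leq0n _)) _; first by lia.
rewrite th0 mulr1 ler_wpM2l// ler_expR ler_wpM2r// ler_nat; lia.
Qed.

Lemma birk_pressure_bound : exists (c : R) (W : nat -> seq A -> R), forall n,
  [/\ forall x, beta * birk n x <= ln (W n (pre n x)),
      forall w : n.-tuple A, 0 < W n w &
      ln (\sum_(w : n.-tuple A) W n w) <= c + n%:R * (htop X0 + (kappa X0 K + ln 2 / (2 ^ K)%:R))].
Proof.
exists (ln C), (fun n => parse_weight n 0) => n.
have W_ge x : expR (beta * birk n x) <= parse_weight n 0 (pre n x).
  exact: (parse_weight_ge 0 x (leqnn n)).
have W_gt0 (w : n.-tuple A) : 0 < parse_weight n 0 w.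
  have -> : (w : seq A) = pre n (nth a0 w : X).
    by rewrite -[LHS](mkseq_nth a0) size_tuple.
  by apply: lt_le_trans (W_ge _); rewrite expR_gt0.
split => //.
  move=> x; have := W_ge x; rewrite -{1}(lnK (x := parse_weight n 0 (pre n x))) ?ler_expR//.
  by rewrite posrE (lt_le_trans _ (W_ge x))// expR_gt0.
have A1 : 1 <= #|A|%:R :> R by rewrite ler1n; apply/card_gt0P; exists a0.
have C0 : 0 < C by apply: divr_gt0 => //; apply: exprn_gt0; exact: lt_le_trans A1.
rewrite -(expRK (n%:R * _)) -lnM ?posrE ?expR_gt0//.
rewrite ler_ln ?posrE ?(mulr_gt0 C0 (expR_gt0 _))//.
  by have := parse_weight_sum (leqnn n) (leq0n _); rewrite th0 mulr1.
have wn : n.-tuple A by exists (nseq n a0); rewrite size_nseq.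
by rewrite (bigD1 wn)//= ltr_pwDl// sumr_ge0// => w _; exact: ltW.
Qed.

End Parsing.

(** * Measurability and integral of the potential *)

(** A prefix that has left the language already shows the exit index, which determines [phi]. *)
Lemma phi_eq_pre m x y : pre m x = pre m y -> ~ lang X0 (pre m x) -> phi x = phi y.
Proof.
move=> xy nlx; have nly : ~ lang X0 (pre m y) by rewrite -xy.
have nx : ~ X0 x by move=> /(lang_X0 m).
have ny : ~ X0 y by move=> /(lang_X0 m).
have [j [lj nj ej]] := dist_set_exit sX0 nx; have [k [lk nk ek]] := dist_set_exit sX0 ny.
have lt_m i (z : X) : lang X0 (pre i z) -> ~ lang X0 (pre m z) -> (i < m)%N.
  by move=> li nz; rewrite ltnNge; apply/negP => mi; apply/nz/(lang_pre sX0 mi li).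
have jm := lt_m _ _ lj nlx; have km := lt_m _ _ lk nly.
rewrite (phi_out nx ej) (phi_out ny ek); congr (- a _).
have [jk|kj|//] := ltngtP j k.
  by case: nj; rewrite -(take_pre x jm) xy take_pre//; exact: (lang_pre sX0 jk lk).
by case: nk; rewrite -(take_pre y km) -xy take_pre//; exact: (lang_pre sX0 kj lj).
Qed.

Lemma measurable_phi : measurable_fun setT phi.
Proof.
pose approx m (x : X) : R := if `[< lang X0 (pre m x) >] then 0 else phi (nth a0 (pre m x)).
apply: (@measurable_fun_cvg _ _ _ _ approx) => [m|x _].
  exact: (measurable_fun_pre m (fun w => if `[< lang X0 w >] then 0 else phi (nth a0 w))).
have [x0|nx] := pselect (X0 x).
  apply: cvg_near_cst; apply: nearW => m; rewrite /approx asboolT ?phi_X0//.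
  exact: lang_X0.
have [j [_ nj _]] := dist_set_exit sX0 nx.
apply: cvg_near_cst; exists j.+1 => // m /= jm.
have nm : ~ lang X0 (pre m x) by move=> /(lang_pre sX0 jm).
have e : pre m (nth a0 (pre m x) : X) = pre m x.
  by apply/eq_pre => i im; rewrite nth_mkseq.
by rewrite /approx asboolF//; apply: (phi_eq_pre e); rewrite e.
Qed.

Definition cost mu : R := fine (\int[mu]_x (- phi x)%:E).

Lemma cost_fin mu : (\int[mu]_x (- phi x)%:E)%E = (cost mu)%:E.
Proof.
rewrite fineK//; apply: (@integral_bounded _ _ _ mu (fun x => - phi x) (a 0%N)).
  by move=> x; rewrite oppr_ge0 phi_le0 lerNl phi_ge.
exact: measurable_funN measurable_phi.
Qed.

Lemma cost_ge0 mu : 0 <= cost mu.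
Proof. by apply: fine_ge0; apply: integral_ge0 => x _; rewrite lee_fin oppr_ge0 phi_le0. Qed.

Lemma integral_phi mu : (\int[mu]_x (phi x)%:E)%E = (- cost mu)%:E.
Proof.
rewrite EFinN -cost_fin -integral_ge0N; last first.
  by move=> x _; rewrite lee_fin oppr_ge0 phi_le0.
by apply: eq_integral => x _; rewrite -EFinN opprK.
Qed.

Lemma measurable_X0 : measurable X0.
Proof.
have -> : X0 = \bigcap_n [set x : X | lang X0 (pre n x)].
  apply/seteqP; split => x; first by move=> x0 n _; exact: lang_X0.
  by move=> hx; apply: (lang_closed sX0) => n; exact: hx.
by apply: bigcap_measurable => // n _; exact: measurable_pre.
Qed.

(** Forward, a Chebyshev bound with [a n > 0] kills each set of points that leave the language
    within [n] letters; backward, [- phi] vanishes on [X0] and is at most [a 0] elsewhere. *)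
Lemma cost_eq0 mu : cost mu = 0 <-> mu X0 = 1%E.
Proof.
have m0 := measurable_X0.
split=> [c0|X01].
  have nl n : mu [set x : X | ~ lang X0 (pre n x)] = 0%E.
    have mn : measurable [set x : X | ~ lang X0 (pre n x)].
      exact: (@measurable_pre _ _ n [set w | ~ lang X0 w]).
    have : ((a n)%:E * mu [set x : X | ~ lang X0 (pre n x)] <= (cost mu)%:E)%E.
      rewrite -cost_fin -[X in mu X]setIT -integral_indic// -ge0_integralZl_EFin//; last 2 first.
      - by apply/measurable_EFinP/measurable_indicP.
      - exact: ltW (weight_gt0 n).
      apply: ge0_le_integral => //.
      - by move=> x _; rewrite mule_ge0// lee_fin// ltW// weight_gt0.
      - by apply/measurable_EFinP/measurable_funM => //; apply/measurable_indicP.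
      - by apply/measurable_EFinP; exact: measurable_funN measurable_phi.
      move=> x _; rewrite indicE; case: (boolP (x \in _)) => [|_].
        by rewrite inE/= => /phi_exit; rewrite mule1 lee_fin lerNr.
      by rewrite mule0 lee_fin oppr_ge0 phi_le0.
    rewrite c0 => le0; apply/eqP; rewrite eq_le measure_ge0 andbT.
    by rewrite -(@pmule_rle0 _ (a n)%:E) ?lte_fin ?weight_gt0.
  have -> : X0 = ~` (~` X0) by rewrite setCK.
  rewrite probability_setC; last exact: measurableC.
  suff -> : mu (~` X0) = 0%E by rewrite sube0.
  apply/negligibleP; first exact: measurableC.
  apply: (@negligibleS _ _ _ _ (\bigcup_n [set x : X | ~ lang X0 (pre n x)])).
    by move=> x nx; have [j [_ nj _]] := dist_set_exit sX0 nx; exists j.+1.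
  apply: negligible_bigcup => n; apply/negligibleP; last exact: nl.
  exact: (@measurable_pre _ _ n [set w | ~ lang X0 w]).
apply/eqP; rewrite eq_le cost_ge0 andbT -lee_fin -cost_fin.
have XC : mu (~` X0) = 0%E by rewrite probability_setC// X01 subee.
apply: (@le_trans _ _ (\int[mu]_x ((a 0%N)%:E * (\1_(~` X0) x)%:E))%E).
  apply: ge0_le_integral => //.
  - by move=> x _; rewrite lee_fin oppr_ge0 phi_le0.
  - by apply/measurable_EFinP; exact: measurable_funN measurable_phi.
  - apply/measurable_EFinP/measurable_funM => //; apply/measurable_indicP; exact: measurableC.
  move=> x _; rewrite indicE; case: (boolP (x \in _)) => [_|].
    by rewrite mule1 lee_fin lerNl phi_ge.
  by rewrite notin_setE/= => /contrapT/phi_X0 ->; rewrite oppr0 mule0.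
rewrite ge0_integralZl_EFin//; last 2 first.
- by apply/measurable_EFinP/measurable_indicP; exact: measurableC.
- exact: ltW (weight_gt0 0).
rewrite integral_indic//; last exact: measurableC.
by rewrite setIT (_ : _ (~` X0) = 0%E) ?mule0//; exact: XC.
Qed.

Lemma pressure_bound : exists b : R, forall mu, invariant mu ->
  ent mu - b * cost mu <= htop X0.
Proof.
have A1 : 1 <= #|A|%:R :> R by rewrite ler1n; apply/card_gt0P; exists a0.
(* One summand for each of the three requirements on [beta]; none of them involves the cap. *)
pose b : R := 1 + ln 12 + ln (2 * #|A|%:R) / a 0%N.
have A2 : 0 < 2 * #|A|%:R :> R by rewrite mulr_gt0// (lt_le_trans ltr01).
have l12 : 0 <= ln 12 :> R by rewrite ln_ge0// ler1n.
have lA : 0 <= ln (2 * #|A|%:R) / a 0%N :> R.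
  by rewrite divr_ge0 ?(ltW (weight_gt0 _))// ln_ge0//; lra.
have b1 : 1 <= b by rewrite /b; lra.
have b2 : expR (- b) <= 12^-1.
  rewrite -[leRHS]lnK ?posrE ?invr_gt0// ler_expR lnV ?posrE//; rewrite /b; lra.
have b3 : #|A|%:R * expR (- (b * a 0%N)) <= 2^-1.
  have : expR (- (b * a 0%N)) <= (2 * #|A|%:R)^-1.
    rewrite -[leRHS]lnK ?posrE ?invr_gt0// ler_expR lnV ?posrE// lerN2.
    rewrite -ler_pdivrMr ?weight_gt0//; rewrite /b; lra.
  rewrite -(@ler_pM2l _ #|A|%:R) ?(lt_le_trans ltr01)//.
  by rewrite invfM mulrCA divff ?mulr1// gt_eqF// (lt_le_trans ltr01).
exists b => mu imu.
(* For a fixed cap, [gibbs_partition] on words of length [n]; the constant [c] is beaten by taking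
   [n] large. *)
have bK K : ent mu - b * cost mu <= htop X0 + (kappa X0 K + ln 2 / (2 ^ K)%:R).
  have [c [W hW]] := birk_pressure_bound K b1 b2 b3.
  set h' := htop X0 + _ in hW *.
  have bn n : (0 < n)%N -> (ent mu - b * cost mu - h') * n%:R <= c.
    move=> n0; have [W1 W2 W3] := hW n.
    have := ent_le imu n0; have := consistent_sum n (mass_consistent mu) => m1.
    have := @gibbs_partition R _ (fun w : n.-tuple A => mass mu w) (fun w => W n w)
      (fun w => let: And3 g _ _ := mass_consistent mu in g w) m1 W2.
    have := @sum_mass_le_integral R A a0 mu (fun x => - phi x) n (fun w => ln (W n w)) b imu
      (measurable_funN measurable_phi) _ _ (le_trans ler01 b1) _.
    rewrite -/(cost mu) cost_fin => /(_ _ isT _) h1.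
    have {}h1 : - \sum_(w : n.-tuple A) mass mu w * ln (W n w) <= b * (n%:R * cost mu).
      apply: h1 => x; first by rewrite oppr_ge0 phi_le0.
      by rewrite sumrN mulrN lerN2; exact: W1.
    rewrite -/(Hword (mass mu) n); move: h1 W3; rewrite /h'; nra.
  rewrite -subr_ge0 -oppr_le0 opprB; rewrite -/h'.
  rewrite leNgt; apply/negP => d0.
  have := bn (Num.Def.archi_bound (`|c| / (ent mu - b * cost mu - h'))).+1 isT.
  have := @archi_boundP R (`|c| / (ent mu - b * cost mu - h')).
  rewrite divr_ge0 ?(ltW d0)// => /(_ isT); rewrite ltr_pdivrMr// => h1.
  have := ler_norm c; rewrite -natr1; nra.
apply/ler_addgt0Pr => e e0.
have e2 : 0 < e / 2 by rewrite divr_gt0.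
have [K0 hK0] := kappa_small sX0 e2.
have [K1 hK1] : exists K1 : nat, ln 2 / (e / 2) < K1%:R :> R.
  exists (Num.Def.archi_bound (ln 2 / (e / 2))); apply: archi_boundP.
  by rewrite divr_ge0 ?ln_ge0 ?ler1n// ltW.
pose K := maxn K0 K1.
have h1 := bK K; have h2 := hK0 K (leq_maxl _ _).
have h3 : ln 2 / (2 ^ K)%:R <= e / 2.
  rewrite ler_pdivrMr ?ltr0n ?expn_gt0// -ler_pdivrMl// mulrC (le_trans (ltW hK1))//.
  by rewrite ler_nat (leq_trans (leq_maxr K0 K1))// ltnW// ltn_expl.
move: h1 h2 h3; rewrite /K; lra.
Qed.

End Potential.

(** * Cross entropy and block measures *)

Section CrossEntropy.
Context {R : realType} {A : finType}.

(** Mixing [m] with the uniform distribution gives a positive [r >= expR (- e) * m], whose cross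
    entropy exceeds the entropy of [m] by at most [e]. *)
Lemma Hword_ge_cross (m : seq A -> R) q c : consistent m ->
  (forall r : seq A -> R, (forall w, 0 < r w) -> \sum_(w : q.-tuple A) r w = 1 ->
     c <= \sum_(w : q.-tuple A) - (m w * ln (r w))) ->
  c <= Hword m q.
Proof.
move=> mc h; have [m0 _ _] := mc; have m1 := consistent_sum q mc.
apply/ler_addgt0Pr => e e0.
pose t : R := expR (- e).
have t0 : 0 < t by rewrite expR_gt0.
have t1 : t < 1 by rewrite -[ltRHS]expR0 ltr_expR oppr_lt0.
have card0 : 0 < #|{: q.-tuple A}|%:R :> R.
  rewrite ltr0n lt0n; apply/eqP => c0; move: m1.
  rewrite big1 => [/esym/eqP|w _]; first by rewrite oner_eq0.
  by have := fintype0 w c0.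
pose r w := t * m w + (1 - t) / #|{: q.-tuple A}|%:R.
have r0 w : 0 < r w by rewrite ltr_wpDl ?mulr_ge0 ?(ltW t0)// divr_gt0// subr_gt0.
have r1 : \sum_(w : q.-tuple A) r w = 1.
  rewrite big_split/= -mulr_sumr m1 mulr1 sumr_const -[_ *+ _]mulr_natr.
  by rewrite divfK ?gt_eqF//; ring.
apply: le_trans (h r r0 r1) _; rewrite -[e in leRHS]mul1r -m1 mulr_suml -big_split/=.
apply: ler_sum => w _; rewrite -mulrN -[X in _ <= X + _]mulrN -mulrDr.
have [->|mw] := eqVneq (m w) 0; first by rewrite !mul0r.
have mw0 : 0 < m w by rewrite lt_neqAle eq_sym mw m0.
rewrite ler_wpM2l ?m0// lerNl opprD opprK -[- e]expRK -/t addrC -lnM ?posrE//.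
rewrite ler_ln ?posrE ?mulr_gt0// /r lerDl divr_ge0// ?(ltW card0)// subr_ge0; exact: ltW.
Qed.

(* Cutting a word into blocks of length q gives the product measure r x r x ..., completed by
   the uniform measure on the last incomplete block. *)
Variables (r : seq A -> R) (q : nat).
Hypothesis q0 : (0 < q)%N.
Hypothesis A0 : (0 < #|A|)%N.
Hypothesis r_gt0 : forall w, 0 < r w.
Hypothesis r_sum : \sum_(w : q.-tuple A) r w = 1.

Fixpoint blocks (fuel : nat) (w : seq A) : R :=
  if fuel is fuel'.+1 then
    if (size w < q)%N then #|A|%:R ^- size w
    else r (take q w) * blocks fuel' (drop q w)
  else #|A|%:R ^- size w.

Let cA0 : 0 < #|A|%:R :> R. Proof. by rewrite ltr0n. Qed.

Lemma blocks_gt0 fuel w : 0 < blocks fuel w.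
Proof.
elim: fuel w => [|fuel IH] w /=; first by rewrite invr_gt0 exprn_gt0.
by case: ifP => _; [rewrite invr_gt0 exprn_gt0|rewrite mulr_gt0].
Qed.

Lemma sum_uniform n : \sum_(w : n.-tuple A) #|A|%:R ^- n = 1 :> R.
Proof.
rewrite sumr_const card_tuple -[_ *+ _]mulr_natr natrX mulVf// expf_neq0//.
by rewrite gt_eqF.
Qed.

Lemma blocks_sum fuel n : (n <= fuel)%N -> \sum_(w : n.-tuple A) blocks fuel w = 1.
Proof.
elim: fuel n => [|fuel IH] n nf.
  by under eq_bigr => w _ do rewrite /= size_tuple; exact: sum_uniform.
under eq_bigr => w _ do rewrite /= size_tuple.
case: ltnP => nq; first exact: sum_uniform.
rewrite (sumw_split (fun w => r (take q w) * blocks fuel (drop q w)) nq).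
rewrite -[RHS]r_sum; apply: eq_bigr => u _.
rewrite -[RHS]mulr1 -(IH (n - q)%N); last first.
  by rewrite leq_subLR (leq_trans nf)// -add1n leq_add2r.
rewrite mulr_sumr; apply: eq_bigr => v _.
by rewrite take_size_cat ?size_tuple// drop_size_cat ?size_tuple.
Qed.

Lemma blocks_fuel f1 f2 w : (size w <= f1)%N -> (size w <= f2)%N ->
  blocks f1 w = blocks f2 w.
Proof.
elim: f1 f2 w => [|f1 IH] [|f2] w//=.
- by move=> w0 _; rewrite (leq_ltn_trans w0).
- by move=> _ w0; rewrite (leq_ltn_trans w0).
move=> h1 h2; case: ltnP => // qw; congr (_ * _); apply: IH; rewrite size_drop; lia.
Qed.

Let T (w : seq A) s : R := - ln (blocks (size w) (drop s w)).

Let T_short w s : (size w < s + q)%N -> T w s <= q%:R * ln #|A|%:R.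
Proof.
move=> wsq; have wq : (size (drop s w) < q)%N by rewrite size_drop; lia.
have -> : T w s = (size (drop s w))%:R * ln #|A|%:R.
  rewrite /T (_ : blocks _ _ = #|A|%:R ^- size (drop s w)).
    by rewrite lnV ?posrE ?exprn_gt0// opprK lnXn// mulr_natl.
  by case: (size w) => //= k; rewrite wq.
by rewrite ler_wpM2r ?ln_ge0 ?ler1n// ler_nat ltnW.
Qed.

Let T_step w s : (s + q <= size w)%N ->
  T w s = - ln (r (take q (drop s w))) + T w (s + q).
Proof.
move=> sq; rewrite /T -opprD -lnM ?posrE ?blocks_gt0//; congr (- ln _).
have sw : (0 < size w)%N by lia.
rewrite -{1}(prednK sw) /= size_drop ltnNge leq_subRL; last by lia.
rewrite sq /= drop_drop addnC; congr (_ * _).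
by apply: blocks_fuel; rewrite size_drop; lia.
Qed.

(* Averaging over the q possible starting offsets uses every window once. *)
Lemma blocks_offsets w :
  \sum_(0 <= j < q) - ln (blocks (size w) (drop j w)) <=
  q%:R * (q%:R * ln #|A|%:R) +
  \sum_(0 <= i < size w | (i + q <= size w)%N) - ln (r (take q (drop i w))).
Proof.
pose lam i := if (i + q <= size w)%N then - ln (r (take q (drop i w))) else 0.
have main k s : (size w <= s + k)%N ->
    \sum_(0 <= j < q) T w (s + j) <= q%:R * (q%:R * ln #|A|%:R) + \sum_(s <= i < s + k) lam i.
  have short s' k' : (size w < s' + q)%N ->
      \sum_(0 <= j < q) T w (s' + j) <= q%:R * (q%:R * ln #|A|%:R) + \sum_(s' <= i < s' + k') lam i.
    move=> wq; have -> : \sum_(s' <= i < s' + k') lam i = 0.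
      rewrite big_nat_cond big1// => i /andP[/andP[si _] _].
      by rewrite /lam leqNgt (leq_trans wq)// leq_add2r.
    rewrite addr0.
    apply: (@le_trans _ _ (\sum_(0 <= j < q) q%:R * ln #|A|%:R)).
      by apply: ler_sum => j _; apply: T_short; rewrite (leq_trans wq)// leq_add2r leq_addr.
    by rewrite sumr_const_nat subn0 [leRHS]mulr_natl.
  elim: k s => [|k IH] s wk; first by apply: short; lia.
  have [sq|/short//] := leqP (s + q) (size w).
  (* Moving the start from [s] to [s + 1] exchanges [T w s] for [T w (s + q)], and these differ by
     exactly the window at [s]. *)
  have e : \sum_(0 <= j < q) T w (s + j) + T w (s + q) = T w s + \sum_(0 <= j < q) T w (s.+1 + j).
    rewrite -(@big_nat_recr _ _ _ q 0 (fun j => T w (s + j)))//= big_nat_recl//= addn0.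
    by congr (_ + _); apply: eq_bigr => j _; rewrite addnS.
  have := IH s.+1; rewrite addSnnS => /(_ wk).
  rewrite [X in _ -> _ <= _ + X](@big_ltn _ _ _ s (s + k.+1)); last by rewrite addnS ltnS leq_addr.
  have -> : lam s = - ln (r (take q (drop s w))) by rewrite /lam sq.
  by move: e; rewrite (T_step sq); lra.
have := main (size w) 0%N; rewrite !add0n => /(_ (leqnn _)).
by rewrite -[X in _ <= _ + X -> _]big_mkcond.
Qed.

End CrossEntropy.

(** * Empirical measures *)

Section Support.
Context {R : realType} {A : finType} {a0 : A}.
Local Notation X := (ShiftSpace a0).
Implicit Types mu : probability X R.
Variable X0 : set X.
Hypothesis sX0 : @is_subshift R A a0 X0.

(** The complement of [X0] is a countable union of cylinders over words outside the language. *)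
Lemma full_measureP mu :
  mu X0 = 1%E <-> forall w, ~ lang X0 w -> mass mu w = 0.
Proof.
have mL n : measurable [set x : X | ~ lang X0 (pre n x)].
  exact: (@measurable_pre _ _ n [set w | ~ lang X0 w]).
have CX0 : ~` X0 = \bigcup_n [set x : X | ~ lang X0 (pre n x)].
  apply/seteqP; split => x /=; last by move=> [n _] /= nl x0; apply/nl/lang_X0.
  by move=> nx; have [j [_ nj _]] := dist_set_exit sX0 nx; exists j.+1.
have mC : measurable (~` X0) by rewrite CX0; exact: bigcupT_measurable.
have mX0 : measurable X0 by rewrite -[X0]setCK; exact: measurableC.
split=> [X01 w nw|h].
  apply: EFin_inj; rewrite -mu_mass; apply/eqP; rewrite eq_le measure_ge0 andbT.
  apply: (@le_trans _ _ (mu (~` X0))); last by rewrite probability_setC// X01 subee.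
  apply: le_measure; rewrite ?inE//; first exact: (@measurable_pre _ _ (size w) [set w]).
  by move=> x /= e x0; apply: nw; rewrite -e; exact: lang_X0.
have nl n : mu [set x : X | ~ lang X0 (pre n x)] = 0%E.
  have -> : [set x : X | ~ lang X0 (pre n x)] =
      \bigcup_(w in [set: n.-tuple A]) (if `[< lang X0 w >] then set0 else cyl a0 w).
    apply/seteqP; split => x /=.
      move=> nx; have s : size (pre n x) == n by rewrite size_pre.
      by exists (Tuple s) => //; rewrite asboolF//= cylE.
    by move=> [w _]; case: asboolP => // nw; rewrite cylE/= => ->.
  rewrite measure_fintype_bigcup; last 2 first.
  - by move=> w; case: ifP => _; [exact: measurable0|exact: measurable_cyl].
  - move=> u v _ _ [x []]; case: ifP => // _; case: ifP => // _; rewrite !cylE/= => e1 e2.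
    by apply: val_inj; rewrite /= -e1 -e2.
  rewrite big1// => w _; case: asboolP => [_|/h e]; first exact: measure0.
  by have := mu_cyl mu w; rewrite e.
rewrite -[X0]setCK probability_setC//.
suff -> : mu (~` X0) = 0%E by rewrite sube0.
apply/negligibleP => //; rewrite CX0; apply: negligible_bigcup => n.
by apply/negligibleP => //; exact: nl.
Qed.

End Support.

Section Empirical.
Context {R : realType} {A : finType} {a0 : A}.
Local Notation X := (ShiftSpace a0).
Implicit Types mu : probability X R.
Variable X0 : set X.
Hypothesis sX0 : @is_subshift R A a0 X0.

Definition point_of (v : seq A) : X := xget (fun=> a0) [set y | X0 y /\ pre (size v) y = v].

Lemma point_ofP v : lang X0 v -> X0 (point_of v) /\ pre (size v) (point_of v) = v.
Proof. by move=> [x hx]; rewrite /point_of; case: xgetP => [y -> //|/(_ x)]. Qed.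

Lemma iter_X0 k x : X0 x -> X0 (iter k shift x).
Proof. by move=> x0; elim: k => // k; have [_ [+ _]] := sX0; exact. Qed.

(* The words have length N + 1, so that the averages below never divide by 0. *)
Definition uni N (v : seq A) : R := (`[< lang X0 v >])%:R / Ncard X0 N.+1.

Definition seen (w : seq A) (x : X) : R := (pre (size w) x == w)%:R.

(** Windows running past the end of [v] still read a point of [X0], so consistency and support hold
    exactly and only stationarity is approximate. *)
Definition empirical N (w : seq A) : R :=
  N.+1%:R^-1 * \sum_(v : N.+1.-tuple A) uni N v *
    \sum_(0 <= i < N.+1) seen w (iter i shift (point_of v)).

Let N0 N : 0 < @Ncard R A a0 X0 N. Proof. exact: lt_le_trans (Ncard_ge1 sX0 N). Qed.

Lemma uni_ge0 N v : 0 <= uni N v. Proof. by rewrite divr_ge0// ltW. Qed.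

Lemma uni_sum N : \sum_(v : N.+1.-tuple A) uni N v = 1.
Proof. by rewrite -mulr_suml -NcardE divff// gt_eqF. Qed.

Lemma seen_rcons w x : \sum_a seen (rcons w a) x = seen w x.
Proof.
rewrite (bigD1 (x (size w)))//= big1 => [|a ax].
  by rewrite /seen size_rcons preS eqseq_rcons eqxx andbT addr0.
by rewrite /seen size_rcons preS eqseq_rcons [_ == a]eq_sym (negbTE ax) andbF.
Qed.

Lemma seen_cons w x : \sum_a seen (a :: w) x = seen w (shift x).
Proof.
rewrite (bigD1 (x 0%N))//= big1 => [|a ax].
  by rewrite /seen pre_shift eqseq_cons eqxx addr0.
by rewrite /seen pre_shift eqseq_cons [_ == a]eq_sym (negbTE ax).
Qed.

Lemma empirical_consistent N : consistent (empirical N).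
Proof.
split=> [w||w].
- rewrite mulr_ge0 ?invr_ge0// sumr_ge0// => v _; rewrite mulr_ge0 ?uni_ge0//.
  by rewrite sumr_ge0.
- rewrite /empirical (eq_bigr (fun v : N.+1.-tuple A => uni N v * N.+1%:R)) => [|v _].
    by rewrite -mulr_suml uni_sum mul1r mulVf.
  by congr (_ * _); rewrite (eq_bigr (fun=> 1))// sumr_const_nat subn0.
- rewrite /empirical -mulr_sumr exchange_big/=; congr (_ * _).
  apply: eq_bigr => v _; rewrite -mulr_sumr exchange_big/=; congr (_ * _).
  by apply: eq_bigr => i _; rewrite seen_rcons.
Qed.

(** Along each orbit the difference telescopes to its two ends. *)
Lemma empirical_shift N w :
  `|\sum_a empirical N (a :: w) - empirical N w| <= N.+1%:R^-1.
Proof.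
have -> : \sum_a empirical N (a :: w) - empirical N w =
    N.+1%:R^-1 * \sum_(v : N.+1.-tuple A) uni N v *
      (seen w (iter N.+1 shift (point_of v)) - seen w (point_of v)).
  rewrite /empirical -mulr_sumr -mulrBr exchange_big/= -sumrB; congr (_ * _).
  apply: eq_bigr => v _; rewrite -mulr_sumr -mulrBr exchange_big/=; congr (_ * _).
  have -> : seen w (iter N.+1 shift (point_of v)) - seen w (point_of v) =
      \sum_(0 <= i < N.+1) (seen w (iter i.+1 shift (point_of v)) - seen w (iter i shift (point_of v))).
    by rewrite (telescope_sumr (fun i => seen w (iter i shift (point_of v)))).
  rewrite -sumrB.
  by apply: eq_bigr => i _; rewrite seen_cons.
rewrite normrM ger0_norm ?invr_ge0// -[leRHS]mulr1 ler_wpM2l ?invr_ge0//.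
rewrite -(uni_sum N) (le_trans (ler_norm_sum _ _ _))//; apply: ler_sum => v _.
rewrite normrM (ger0_norm (uni_ge0 _ _)) ler_piMr ?uni_ge0// /seen.
by do 2 case: eqP => _; rewrite /= ?subrr ?subr0 ?sub0r ?normrN ?normr0 ?normr1.
Qed.

Lemma empirical_support N w : ~ lang X0 w -> empirical N w = 0.
Proof.
move=> nw; rewrite /empirical big1 ?mulr0// => v _; rewrite /uni.
case: asboolP => [/point_ofP[p0 _]|_]; last by rewrite !mul0r.
rewrite big1 ?mulr0// => i _; rewrite /seen; case: eqP => // e; case: nw.
by rewrite -e; apply/lang_X0/iter_X0.
Qed.

(** A dual form of Misiurewicz's argument: the uniform law on language words has entropy
    [ln (Ncard X0 n)], at most its cross entropy against each of [q] shifted block products. The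
    factor 2 counts the two ragged ends. *)
Lemma empirical_cross N q (r : seq A -> R) : (0 < q)%N -> (forall w, 0 < r w) ->
  \sum_(w : q.-tuple A) r w = 1 ->
  q%:R * (htop X0 * N.+1%:R) <= q%:R * (q%:R * ln #|A|%:R) * 2 +
    N.+1%:R * \sum_(w : q.-tuple A) - (empirical N w * ln (r w)).
Proof.
move=> q0 r0 r1; set n := N.+1.
have A0 : (0 < #|A|)%N by apply/card_gt0P; exists a0.
have lA : 0 <= ln #|A|%:R :> R by rewrite ln_ge0// ler1n.
have rle1 (w : seq A) : size w = q -> r w <= 1.
  move=> sw; have s : size w == q by rewrite sw.
  by rewrite -r1 (bigD1 (Tuple s))//= lerDl sumr_ge0// => v _; exact: ltW.
apply: (@le_trans _ _ (q%:R * ln (Ncard X0 n))).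
  by rewrite ler_wpM2l// htop_le.
(* Uniform on the [j] letters before the first block; [minn] covers offsets beyond the end of the
   word. *)
pose Q j (v : seq A) := #|A|%:R ^- minn j n * blocks r q n (drop j v).
have Qgt0 j v : 0 < Q j v by rewrite mulr_gt0 ?blocks_gt0// invr_gt0 exprn_gt0// ltr0n.
have Qsum j : \sum_(v : n.-tuple A) Q j v = 1.
  rewrite (sumw_split (Q j) (geq_minr j n)) -[RHS](sum_uniform A0 (minn j n)).
  apply: eq_bigr => u _; rewrite -[RHS]mulr1.
  rewrite -[X in _ = _ * X](@blocks_sum _ _ _ q q0 A0 r1 n (n - minn j n)) ?leq_subr// mulr_sumr.
apply: eq_bigr => v _; rewrite /Q; congr (_ * blocks _ _ _ _).
  have [jn|] := boolP (j <= n)%N; first by rewrite drop_size_cat// size_tuple (minn_idPl jn).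
  rewrite -ltnNge => nj; have mE := minn_idPr (ltnW nj).
  have /size0nil -> : size v = 0%N by rewrite size_tuple mE subnn.
  by rewrite cats0 drop_oversize// size_tuple mE ltnW.
have lnN : ln (Ncard X0 n) = \sum_(v : n.-tuple A) - (uni N v * ln (uni N v)).
  transitivity (\sum_(v : n.-tuple A) uni N v * ln (@Ncard R A a0 X0 n)).
    by rewrite -mulr_suml uni_sum mul1r.
  apply: eq_bigr => v _; rewrite /uni; case: asboolP => _; last by rewrite !mul0r oppr0.
  by rewrite mul1r lnV ?posrE// mulrN opprK.
have step1 j : ln (Ncard X0 n) <= \sum_(v : n.-tuple A) - (uni N v * ln (Q j v)).
  rewrite lnN; apply: (@gibbs _ _ (fun v : n.-tuple A => uni N v) (fun v => Q j v)).
  - by move=> v; exact: uni_ge0.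
  - by move=> v; exact: ltW.
  - by move=> v /eqP; rewrite gt_eqF.
  - by rewrite Qsum uni_sum.
have -> : q%:R * ln (Ncard X0 n) = \sum_(0 <= j < q) ln (@Ncard R A a0 X0 n).
  by rewrite sumr_const_nat subn0 mulr_natl.
apply: (@le_trans _ _ (\sum_(0 <= j < q) \sum_(v : n.-tuple A) - (uni N v * ln (Q j v)))).
  exact: ler_sum.
rewrite exchange_big/=.
have step2 (v : n.-tuple A) : \sum_(0 <= j < q) - (uni N v * ln (Q j v)) <=
   uni N v * (q%:R * (q%:R * ln #|A|%:R) * 2 +
     \sum_(0 <= i < n) - ln (r (pre q (iter i shift (point_of v))))).
  have -> : \sum_(0 <= j < q) - (uni N v * ln (Q j v)) =
      uni N v * \sum_(0 <= j < q) - ln (Q j v).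
    by rewrite mulr_sumr; apply: eq_bigr => j _; rewrite mulrN.
  have [lv|nlv] := pselect (lang X0 v); last by rewrite /uni asboolF// !mul0r.
  rewrite ler_wpM2l ?uni_ge0//.
  have [px pv] := point_ofP lv; rewrite size_tuple in pv.
  have := @blocks_offsets R A r q q0 A0 r0 v; rewrite size_tuple => h.
  have h2 : \sum_(0 <= i < n | (i + q <= n)%N) - ln (r (take q (drop i v))) <=
      \sum_(0 <= i < n) - ln (r (pre q (iter i shift (point_of v)))).
    rewrite big_mkcond/= !big_nat; apply: ler_sum => i /= ilt; case: ifP => iq.
      by rewrite -{1}pv drop_pre ?take_pre//; lia.
    by rewrite oppr_ge0 ln_le0// rle1// size_pre.
  have h3 : \sum_(0 <= j < q) - ln (Q j v) <=
      q%:R * (q%:R * ln #|A|%:R) + \sum_(0 <= j < q) - ln (blocks r q n (drop j v)).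
    have -> : q%:R * (q%:R * ln #|A|%:R) = \sum_(0 <= j < q) q%:R * ln #|A|%:R :> R.
      by rewrite sumr_const_nat subn0 [LHS]mulr_natl.
    rewrite -big_split/= !big_nat; apply: ler_sum => j /= jq.
    rewrite lnM ?posrE ?blocks_gt0// ?invr_gt0 ?exprn_gt0 ?ltr0n//.
    rewrite lnV ?posrE ?exprn_gt0 ?ltr0n// lnXn ?ltr0n// opprD opprK lerD2r.
    rewrite -[leLHS]mulr_natl ler_wpM2r// ler_nat; lia.
  move: h h2 h3; lra.
apply: (le_trans (ler_sum _ (fun v _ => step2 v))).
rewrite (eq_bigr _ (fun v _ => mulrDr _ _ _)) big_split/= -mulr_suml uni_sum mul1r lerD2l.
rewrite le_eqVlt; apply/orP; left; apply/eqP.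
rewrite mulr_sumr.
have lnr x : - ln (r (pre q x)) = \sum_(w : q.-tuple A) seen w x * - ln (r w).
  have s : size (pre q x) == q by rewrite size_pre.
  rewrite (bigD1 (Tuple s))//= big1 => [|w wx].
    by rewrite /seen size_pre eqxx mul1r addr0.
  rewrite /seen size_tuple; case: eqP => [e|_]; last by rewrite mul0r.
  by case/eqP: wx; apply: val_inj.
under eq_bigr => v _ do under eq_bigr => i _ do rewrite lnr.
under eq_bigr => v _ do rewrite exchange_big/= mulr_sumr.
rewrite exchange_big/=; apply: eq_bigr => w _.
have nE : n%:R * empirical N w = \sum_(v : N.+1.-tuple A) uni N v *
    \sum_(0 <= i < N.+1) seen w (iter i shift (point_of v)).
  by rewrite /empirical /n mulrA divff ?mul1r // pnatr_eq0.
rewrite -mulrN [RHS]mulrA nE mulr_suml.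
by apply: eq_bigr => v _; rewrite -mulr_suml mulrA.
Qed.

End Empirical.

(** * Existence of a measure of maximal entropy *)

Section Existence.
Context {R : realType} {A : finType} {a0 : A}.
Local Notation X := (ShiftSpace a0).
Implicit Types mu : probability X R.

Lemma cvg_finsum (T : Type) (F : set_system T) (FF : Filter F) (I : finType)
    (f : I -> T -> R) (l : I -> R) :
  (forall i, (f i t @[t --> F]) --> l i) ->
  (\sum_i f i t @[t --> F]) --> \sum_i l i.
Proof.
move=> fl; elim: (index_enum I) => [|i s IH].
  under eq_fun do rewrite big_nil; rewrite big_nil; exact: cvg_cst.
by under eq_fun do rewrite big_cons; rewrite big_cons; exact: cvgD.
Qed.

Lemma stationary_of_mass m : stationary m ->
  exists mu, invariant mu /\ mass mu = m.
Proof.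
move=> [mc ms]; have [mu mE] := @probability_of_consistent R A a0 m mc.
exists mu; split => //; apply: invariant_stationary => w; rewrite mE; exact: ms.
Qed.

(** The Bernoulli measure with equal weights; it provides a measure of positive cost when [X0] is
    proper. *)
Lemma uniform_measure_ex : exists mu, invariant mu /\ forall w, 0 < mass mu w.
Proof.
have A0 : (#|A|%:R : R) != 0 by rewrite pnatr_eq0 -lt0n; apply/card_gt0P; exists a0.
have Ap : 0 < (#|A|%:R : R) by rewrite lt0r A0 ler0n.
have E (w : seq A) : \sum_(b : A) #|A|%:R ^- (size w).+1 = #|A|%:R ^- size w :> R.
  rewrite sumr_const -[LHS]mulr_natr exprS invfM mulrC mulrA.
  by rewrite [X in X * _](_ : _ = 1) ?mul1r//; exact: mulfV.
have [|mu [imu mE]] := @stationary_of_mass (fun w => #|A|%:R ^- size w).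
  split; last by move=> w; exact: E.
  split => [w||w]; first by rewrite invr_ge0 exprn_ge0.
    by rewrite expr0 invr1.
  by under eq_bigr => b _ do rewrite size_rcons; exact: E.
by exists mu; split => // w; rewrite mE invr_gt0 exprn_gt0.
Qed.

Lemma integral_seen mu (w : seq A) :
  (\int[mu]_x ((pre (size w) x == w)%:R)%:E)%E = (mass mu w)%:E.
Proof.
rewrite (@integral_pre _ _ _ mu (size w) (fun v => (v == w)%:R))//.
rewrite (bigD1 (in_tuple w))//= eqxx mulr1 big1 ?addr0// => v vw.
case: eqP => [e|_]; last by rewrite mulr0.
by case/eqP: vw; apply: val_inj.
Qed.

Variable X0 : set X.
Hypothesis sX0 : @is_subshift R A a0 X0.

(** Empirical masses converge along an ultrafilter finer than [\oo]; the stationarity error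
    vanishes, and [empirical_cross] passes to the limit for each positive [r]. *)
Lemma max_entropy_ex : exists mu, [/\ invariant mu, mu X0 = 1%E & htop X0 <= ent mu].
Proof.
have [U [UU ooU]] := ultraFilterLemma (eventually_filter : ProperFilter \oo).
have PU : ProperFilter U by exact: ultra_proper.
pose e := @empirical R A a0 X0.
have ec N : consistent (e N) := empirical_consistent sX0 N.
have ecv w : cvg (e N w @[N --> U]).
  apply: (@ultra_bounded_cvg _ _ _ 1) => N; rewrite ger0_norm; first exact: consistent_le1.
  by have [] := ec N.
pose m w : R := lim (e N w @[N --> U]).
have em w : (e N w @[N --> U]) --> m w := ecv w.
have hU : hausdorff_space R by exact: Rhausdorff.
have inv0 : (N.+1%:R^-1 : R) @[N --> U] --> (0 : R).
  by move=> V V0; apply: ooU; exact: (@cvg_harmonic R V V0).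
have mc : consistent m.
  split=> [w||w].
  - by apply: limr_ge => //; apply: nearW => N; have [] := ec N.
  - apply: (cvg_unique hU (em [::])).
    rewrite (_ : (fun N => e N [::]) = fun=> 1); first exact: cvg_cst.
    by apply/funext => N; have [] := ec N.
  - have h : (\sum_b e N (rcons w b) @[N --> U]) --> \sum_b m (rcons w b).
      exact: cvg_finsum.
    have e1 : (fun N => \sum_b e N (rcons w b)) = e^~ w.
      by apply/funext => N; have [_ _ ->] := ec N.
    by rewrite e1 in h; exact: (cvg_unique hU h (em w)).
have ms : stationary m.
  split=> // w.
  have h1 : (\sum_b e N (b :: w) - e N w @[N --> U]) --> \sum_b m (b :: w) - m w.
    by apply: cvgB => //; exact: cvg_finsum.
  have h2 : (\sum_b e N (b :: w) - e N w @[N --> U]) --> (0 : R).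
    apply: norm_cvg0; apply: (squeeze_cvgr _ (cvg_cst 0) inv0).
    by apply: nearW => N; rewrite normr_ge0/= empirical_shift.
  by apply/eqP; rewrite -subr_eq0; apply/eqP; exact: (cvg_unique hU h1 h2).
have [mu [imu mE]] := stationary_of_mass ms.
exists mu; split => //.
  apply/(full_measureP sX0) => w nw; rewrite mE.
  apply: (cvg_unique hU (em w)).
  rewrite (_ : (fun N => e N w) = fun=> 0); first exact: cvg_cst.
  by apply/funext => N; exact: empirical_support.
apply: le_ent => // q q0; rewrite mE; apply: Hword_ge_cross => // r r0 r1.
pose c : R := q%:R * (q%:R * ln #|A|%:R) * 2.
have h1 : (c * N.+1%:R^-1 + \sum_(w : q.-tuple A) - (e N w * ln (r w)) @[N --> U]) -->
    c * 0 + \sum_(w : q.-tuple A) - (m w * ln (r w)).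
  apply: cvgD; first by apply: cvgM => //; exact: cvg_cst.
  by apply: cvg_finsum => w; apply: cvgN; apply: cvgM => //; exact: cvg_cst.
rewrite -[leRHS]add0r -[X in X + _](mulr0 c) -(cvg_lim hU h1).
apply: limr_ge; first by apply/cvg_ex; eexists; exact: h1.
apply: nearW => N; have := empirical_cross sX0 N q0 r0 r1.
set s := \sum_w _; rewrite -/e => h.
have N0 : 0 < N.+1%:R :> R by [].
have : htop X0 * q%:R * N.+1%:R <= (c * N.+1%:R^-1 + s) * N.+1%:R.
  by rewrite mulrDl divfK ?gt_eqF//; move: h; rewrite /c; lra.
by rewrite ler_pM2r.
Qed.

End Existence.

(** * The theorem *)

Section Limits.
Context {R : realType} {A : finType} {a0 : A}.
Local Notation X := (ShiftSpace a0).
Implicit Types mu : probability X R.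
Variable X0 : set X.
Hypothesis sX0 : @is_subshift R A a0 X0.

(* Upper semicontinuity of entropy: the word entropy is dominated by cross entropies, which
   are linear in the measure. *)
Lemma mme_vague_limit (mus : nat -> probability X R) mu :
  (forall w, (mass (mus n) w @[n --> \oo]) --> mass mu w) ->
  (\forall n \near \oo, mme X0 (mus n)) ->
  [/\ invariant mu, mu X0 = 1%E & htop X0 <= ent mu].
Proof.
move=> cm nm.
have hU : hausdorff_space R by exact: Rhausdorff.
have imu : invariant mu.
  apply: invariant_stationary => w.
  have h1 : (\sum_b mass (mus n) (b :: w) @[n --> \oo]) --> \sum_b mass mu (b :: w).
    exact: cvg_finsum.
  have h2 : (\sum_b mass (mus n) (b :: w) @[n --> \oo]) --> mass mu w.
    apply: cvg_trans (cm w); apply: near_eq_cvg; near=> n.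
    have : mme X0 (mus n) by near: n.
    by move=> [/mass_stationary[_ ->] _].
  exact: (cvg_unique hU h1 h2).
split => //.
  apply/(full_measureP sX0) => w nw.
  have h1 : (mass (mus n) w @[n --> \oo]) --> (0 : R).
    apply: cvg_near_cst; near=> n.
    have : mme X0 (mus n) by near: n.
    by move=> [_ [/(full_measureP sX0) h _]]; exact: h.
  exact: (cvg_unique hU (cm w) h1).
apply: le_ent => // q q0; apply: Hword_ge_cross; first exact: mass_consistent.
move=> r r0 r1.
have h1 : (\sum_(w : q.-tuple A) - (mass (mus n) w * ln (r w)) @[n --> \oo]) -->
    \sum_(w : q.-tuple A) - (mass mu w * ln (r w)).
  by apply: cvg_finsum => w; apply: cvgN; apply: cvgM => //; exact: cvg_cst.
rewrite -(cvg_lim hU h1); apply: limr_ge; first by apply/cvg_ex; eexists; exact: h1.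
near=> n; have : mme X0 (mus n) by near: n.
move=> [imn [_ <-]]; apply: le_trans (ent_le imn q0) _.
have mc := mass_consistent (mus n).
apply: (@gibbs _ _ (fun w : q.-tuple A => mass (mus n) w) (fun w => r w)).
- by move=> w; have [] := mc.
- by move=> w; exact: ltW.
- by move=> w /eqP; rewrite gt_eqF.
- by rewrite r1 consistent_sum.
Unshelve. all: by end_near. Qed.

End Limits.

Theorem theorem5p3 (R : realType) (A : finType) (a0 : A)
  (X0 : set (ShiftSpace a0)) (a : nat -> R) (phi : ShiftSpace a0 -> R) :
  @is_subshift R A a0 X0 ->
  X0 != setT ->
  (forall i j, (i <= j)%N -> a j <= a i) ->
  (forall j : nat, (0 < j)%N ->
     2 * ln (j%:R) / j%:R
     + j%:R^-1 * (\sum_(0 <= i < (trunc_log 2 j).+1) (2 ^ i)%:R * kappa X0 i)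
     + j%:R^-1 <= a (3 * j)%N) ->
  (forall x, X0 x -> phi x = 0) ->
  (forall x (j : nat), ~ X0 x -> dist_set x X0 = (2^-1 : R) ^+ j -> phi x = - a j) ->
  freezing_phase_transition phi /\ ZTA phi `<=` mme X0.
Proof.
move=> sX0 proper a_noninc a_ge phi_X0 phi_out.
have int_phi := integral_phi sX0 a_noninc a_ge phi_X0 phi_out.
have c_ge0 := cost_ge0 sX0 a_noninc a_ge phi_X0 phi_out.
have c_eq0 := cost_eq0 sX0 a_noninc a_ge phi_X0 phi_out.
have [b0 Gb0] := pressure_bound sX0 a_noninc a_ge phi_X0 phi_out.
pose G b := forall nu : probability (ShiftSpace a0) R, invariant nu -> ent nu - b * cost phi nu <= htop X0.
have G_le b b' : b <= b' -> G b -> G b'.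
  move=> bb Gb nu inu; apply: le_trans (Gb nu inu).
  by rewrite lerD2l lerN2 ler_wpM2r.
have mmeE mu : mme X0 mu <-> [/\ invariant mu, cost phi mu = 0 & ent mu = htop X0].
  by split=> [[h1 [/c_eq0 h2 h3]]|[h1 /c_eq0 h2 h3]].
have [mu0 [imu0 /c_eq0 cmu0 emu0]] := max_entropy_ex sX0.
have mmu0 : mme X0 mu0.
  apply/mmeE; split => //; apply/eqP; rewrite eq_le emu0 andbT.
  by have := Gb0 _ imu0; rewrite cmu0 mulr0 subr0.
have ESE b mu : ES phi b mu <-> invariant mu /\ forall nu : probability (ShiftSpace a0) R, invariant nu ->
    ent nu - b * cost phi nu <= ent mu - b * cost phi mu.
  by split=> -[imu h]; split => // nu inu; have := h nu inu;
    rewrite !int_phi -!EFinM -!EFinD lee_fin !mulrN.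
(* Slack argument: an equilibrium state at [b] has pressure at least [htop X0], so with positive
   cost it would break the bound at the smaller [c]. *)
have ES_mme b c : c < b -> G c -> ES phi b = mme X0.
  move=> cb Gc; apply/seteqP; split => mu.
    move=> /ESE[imu h]; apply/mmeE.
    have [_ _ em0] := (mmeE mu0).1 mmu0.
    have := h mu0 imu0; rewrite cmu0 mulr0 subr0 em0 => h1.
    have h2 := Gc mu imu; have h3 := c_ge0 mu.
    have c0 : cost phi mu = 0.
      apply/eqP; rewrite eq_le h3 andbT leNgt; apply/negP => h4.
      have : c * cost phi mu < b * cost phi mu by rewrite ltr_pM2r.
      lra.
    by split => //; move: h1 h2; rewrite c0; lra.
  move=> /mmeE[imu cmu emu]; apply/ESE; split => // nu inu.
  rewrite cmu mulr0 subr0 emu; exact: (G_le _ _ (ltW cb) Gc).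
have [rho [irho mrho]] := @uniform_measure_ex R A a0.
(* At zero cost every word, having positive mass, would lie in the language, and [X0] would be the
   full shift. *)
have crho : 0 < cost phi rho.
  rewrite lt0r c_ge0 andbT; apply/eqP => /c_eq0/(full_measureP sX0) h.
  move/eqP: proper; apply; apply/seteqP; split => // x _.
  apply: (lang_closed sX0) => n; apply: contrapT => /h.
  by move=> e; have := mrho (pre n x); rewrite e ltxx.
pose S : set R := [set b | G b].
have lbS : lbound S ((ent rho - htop X0) / cost phi rho).
  move=> b /(_ rho irho); rewrite ler_pdivrMr//; lra.
have SI : has_inf S by split; [exists b0 | exists ((ent rho - htop X0) / cost phi rho)].
have above b : inf S < b -> ES phi b = mme X0.
  move=> hb; have e0 : 0 < b - inf S by rewrite subr_gt0.
  have [c Gc cb] := inf_adherent e0 SI.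
  by apply: (ES_mme b c) => //; move: cb; rewrite addrC subrK.
split.
  exists (inf S); split=> [b b' hb hb'|b b' hb hb' e]; first by rewrite !above.
  have : ES phi b mu0 by rewrite e above.
  (* If [mu0] is still an equilibrium state at [b], its optimality is precisely [G b], so [b] cannot
     lie below the infimum. *)
  move=> /ESE[_ h]; have : inf S <= b.
    apply: ge_inf; first by case: SI.
    move=> nu inu; have := h nu inu; have [_ _ em0] := (mmeE mu0).1 mmu0.
    by rewrite cmu0 mulr0 subr0 em0.
  by rewrite leNgt hb.
move=> mu [beta [mus [betaoo [hES hcv]]]].
have nm : \forall n \near \oo, mme X0 (mus n).
  have /cvgryPgt/(_ (inf S)) := betaoo.
  by apply: filterS => n hn; rewrite -(above _ hn).
(* Indicators of cylinders are continuous for [dist], so vague convergence gives convergence of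
   every mass. *)
have cm w : (mass (mus n) w @[n --> \oo]) --> mass mu w.
  have := hcv (fun x => ((pre (size w) x == w)%:R)) (dcontinuous_pre _ (fun v => (v == w)%:R)).
  rewrite integral_seen.
  under eq_fun do rewrite integral_seen.
  by move=> /fine_cvg.
have [imu /c_eq0 cmu emu] := mme_vague_limit sX0 cm nm.
apply/mmeE; split => //; apply/eqP; rewrite eq_le emu andbT.
by have := Gb0 _ imu; rewrite cmu mulr0 subr0.
Qed.
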